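(* $\mathbf{IKP}(\mathcal{P})+\Sigma^{\mathcal P}\text{-Reflection}$ is conservative over $\mathbf{IKP}(\mathcal{P})$ for $\Sigma^{\mathcal P}$-sentences.
   Context: The language of $\mathbf{IKP}(\mathcal{P})$ is that of set theory with, in addition, primitive subset-bounded quantifiers $(\forall x\subseteq a)$, $(\exists x\subseteq a)$; $a\subseteq b$ abbreviates $(\forall x\in a)(x\in b)$. $\Delta_0^{\mathcal P}$-formulas are those without unbounded quantifiers. $\mathbf{IKP}(\mathcal P)$ has intuitionistic logic and axioms: Extensionality for $\Delta_0^{\mathcal P}$ formulas, Pair, Union, Infinity, $\Delta_0^{\mathcal P}$-Separation, $\Delta_0^{\mathcal P}$-Collection, Set Induction for all formulas, and Power Set $\exists z(\forall x\subseteq a)(x\in z)$. $\Sigma^{\mathcal P}$- and $\Pi^{\mathcal P}$-formulas: both contain the $\Delta_0^{\mathcal P}$-formulas and are closed under $\wedge,\vee$, $(\forall x\in s),(\exists x\in s),(\forall x\subseteq s),(\exists x\subseteq s)$; $\Sigma^{\mathcal P}$ is closed under $\exists x$, and contains $\neg C$, $C\to A$ whenever $A$ is $\Sigma^{\mathcal P}$ and $C$ is $\Pi^{\mathcal P}$; dually $\Pi^{\mathcal P}$ is closed under $\forall x$ and contains $\neg D$, $D\to A$ whenever $A$ is $\Pi^{\mathcal P}$ and $D$ is $\Sigma^{\mathcal P}$. $\Sigma^{\mathcal P}$-Reflection is the schema $A\to\exists z\,A^{z}$ for $\Sigma^{\mathcal P}$-formulas $A$, where $A^{z}$ restricts every unbounded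 quantifier of $A$ to $z$. *)

(* Defs.v *)
(* Deep embedding of the first-order language of IKP(P),
   intuitionistic natural deduction, the theory IKP(P), the formula classes
   Delta0^P, Sigma^P, Pi^P, and the Sigma^P-Reflection schema.
   Variables are de Bruijn indices; the only terms are variables. *)
From Stdlib Require Import List.
Import ListNotations.

Inductive form : Type :=
| FIn  : nat -> nat -> form          (* FIn i j :  v_i \in v_j *)
| FBot : form
| FAnd : form -> form -> form
| FOr  : form -> form -> form
| FImp : form -> form -> form
| FAll : form -> form                (* forall x, A   (x = var 0 in A) *)
| FEx  : form -> form
| FBAll : nat -> form -> form        (* FBAll i A : (forall x \in v_i) A ; i read outside the binder *)
| FBEx  : nat -> form -> form
| FSAll : nat -> form -> form        (* (forall x \subseteq v_i) A  (primitive) *)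
| FSEx  : nat -> form -> form.

Definition FNeg (A : form) : form := FImp A FBot.
Definition FIff (A B : form) : form := FAnd (FImp A B) (FImp B A).

Definition FSub (a b : nat) : form := FBAll a (FIn 0 (S b)).
Definition FEq (a b : nat) : form := FAnd (FSub a b) (FSub b a).

Definition up (s : nat -> nat) : nat -> nat :=
  fun n => match n with 0 => 0 | S m => S (s m) end.

Fixpoint rename (s : nat -> nat) (A : form) : form :=
  match A with
  | FIn i j => FIn (s i) (s j)
  | FBot => FBot
  | FAnd B C => FAnd (rename s B) (rename s C)
  | FOr B C => FOr (rename s B) (rename s C)
  | FImp B C => FImp (rename s B) (rename s C)
  | FAll B => FAll (rename (up s) B)
  | FEx B => FEx (rename (up s) B)
  | FBAll i B => FBAll (s i) (rename (up s) B)
  | FBEx i B => FBEx (s i) (rename (up s) B)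
  | FSAll i B => FSAll (s i) (rename (up s) B)
  | FSEx i B => FSEx (s i) (rename (up s) B)
  end.

Definition shift (A : form) : form := rename S A.

Definition subst0 (t : nat) (A : form) : form :=
  rename (fun n => match n with 0 => t | S m => m end) A.

Fixpoint closed_at (n : nat) (A : form) : Prop :=
  match A with
  | FIn i j => i < n /\ j < n
  | FBot => True
  | FAnd B C | FOr B C | FImp B C => closed_at n B /\ closed_at n C
  | FAll B | FEx B => closed_at (S n) B
  | FBAll i B | FBEx i B | FSAll i B | FSEx i B => i < n /\ closed_at (S n) B
  end.

Definition sentence (A : form) : Prop := closed_at 0 A.

Fixpoint Delta0P (A : form) : Prop :=
  match A with
  | FIn _ _ | FBot => True
  | FAnd B C | FOr B C | FImp B C => Delta0P B /\ Delta0P C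
  | FAll _ | FEx _ => False
  | FBAll _ B | FBEx _ B | FSAll _ B | FSEx _ B => Delta0P B
  end.

Inductive SigmaP : form -> Prop :=
| Sig_D0 A : Delta0P A -> SigmaP A
| Sig_And A B : SigmaP A -> SigmaP B -> SigmaP (FAnd A B)
| Sig_Or A B : SigmaP A -> SigmaP B -> SigmaP (FOr A B)
| Sig_BAll i A : SigmaP A -> SigmaP (FBAll i A)
| Sig_BEx i A : SigmaP A -> SigmaP (FBEx i A)
| Sig_SAll i A : SigmaP A -> SigmaP (FSAll i A)
| Sig_SEx i A : SigmaP A -> SigmaP (FSEx i A)
| Sig_Ex A : SigmaP A -> SigmaP (FEx A)
| Sig_Neg C : PiP C -> SigmaP (FNeg C)
| Sig_Imp C A : PiP C -> SigmaP A -> SigmaP (FImp C A)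
with PiP : form -> Prop :=
| Pi_D0 A : Delta0P A -> PiP A
| Pi_And A B : PiP A -> PiP B -> PiP (FAnd A B)
| Pi_Or A B : PiP A -> PiP B -> PiP (FOr A B)
| Pi_BAll i A : PiP A -> PiP (FBAll i A)
| Pi_BEx i A : PiP A -> PiP (FBEx i A)
| Pi_SAll i A : PiP A -> PiP (FSAll i A)
| Pi_SEx i A : PiP A -> PiP (FSEx i A)
| Pi_All A : PiP A -> PiP (FAll A)
| Pi_Neg D : SigmaP D -> PiP (FNeg D)
| Pi_Imp D A : SigmaP D -> PiP A -> PiP (FImp D A).

Fixpoint relz (z : nat) (A : form) : form :=
  match A with
  | FIn i j => FIn i j
  | FBot => FBot
  | FAnd B C => FAnd (relz z B) (relz z C)
  | FOr B C => FOr (relz z B) (relz z C)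
  | FImp B C => FImp (relz z B) (relz z C)
  | FAll B => FBAll z (relz (S z) B)
  | FEx B => FBEx z (relz (S z) B)
  | FBAll i B => FBAll i (relz (S z) B)
  | FBEx i B => FBEx i (relz (S z) B)
  | FSAll i B => FSAll i (relz (S z) B)
  | FSEx i B => FSEx i (relz (S z) B)
  end.

Inductive bq_axiom : form -> Prop :=
| bq_BAll i A : bq_axiom (FIff (FBAll i A) (FAll (FImp (FIn 0 (S i)) A)))
| bq_BEx i A : bq_axiom (FIff (FBEx i A) (FEx (FAnd (FIn 0 (S i)) A)))
| bq_SAll i A : bq_axiom (FIff (FSAll i A) (FAll (FImp (FSub 0 (S i)) A)))
| bq_SEx i A : bq_axiom (FIff (FSEx i A) (FEx (FAnd (FSub 0 (S i)) A))).

Inductive prv (T : form -> Prop) : list form -> form -> Prop :=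
| P_Ctx G A : In A G -> prv T G A
| P_Ax G A : T A -> prv T G A
| P_Bq G A : bq_axiom A -> prv T G A
| P_BotE G A : prv T G FBot -> prv T G A
| P_ImpI G A B : prv T (A :: G) B -> prv T G (FImp A B)
| P_ImpE G A B : prv T G (FImp A B) -> prv T G A -> prv T G B
| P_AndI G A B : prv T G A -> prv T G B -> prv T G (FAnd A B)
| P_AndE1 G A B : prv T G (FAnd A B) -> prv T G A
| P_AndE2 G A B : prv T G (FAnd A B) -> prv T G B
| P_OrI1 G A B : prv T G A -> prv T G (FOr A B)
| P_OrI2 G A B : prv T G B -> prv T G (FOr A B)
| P_OrE G A B C : prv T G (FOr A B) -> prv T (A :: G) C -> prv T (B :: G) C -> prv T G C
| P_AllI G A : prv T (map shift G) A -> prv T G (FAll A)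
| P_AllE G A t : prv T G (FAll A) -> prv T G (subst0 t A)
| P_ExI G A t : prv T G (subst0 t A) -> prv T G (FEx A)
| P_ExE G A B : prv T G (FEx A) -> prv T (A :: map shift G) (shift B) -> prv T G B.

Definition Provable (T : form -> Prop) (A : form) : Prop := prv T [] A.

Inductive IKPP : form -> Prop :=
| ax_ext B a b : Delta0P B ->
    IKPP (FImp (FAnd (FEq a b) (subst0 a B)) (subst0 b B))
| ax_pair a b : IKPP (FEx (FAnd (FIn (S a) 0) (FIn (S b) 0)))
| ax_union a : IKPP (FEx (FBAll (S a) (FBAll 0 (FIn 0 2))))
| ax_inf : IKPP (FEx (FAnd (FEx (FIn 0 1)) (FBAll 0 (FBEx 1 (FIn 1 0)))))
| ax_sep B a : Delta0P B ->
    IKPP (FEx (FAll (FIff (FIn 0 1) (FAnd (FIn 0 (S (S a))) (rename (up S) B)))))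
(* Delta0^P-Collection: (forall x \in a) exists y B(x,y) -> exists z (forall x \in a)(exists y \in z) B(x,y)
   (in B: var 0 = y, var 1 = x) *)
| ax_coll B a : Delta0P B ->
    IKPP (FImp (FBAll a (FEx B))
               (FEx (FBAll (S a) (FBEx 1 (rename (up (up S)) B)))))
| ax_ind C :
    IKPP (FImp (FAll (FImp (FBAll 0 (rename (up S) C)) C)) (FAll C))
| ax_pow a : IKPP (FEx (FSAll (S a) (FIn 0 1))).

Inductive SigmaP_Refl : form -> Prop :=
| ax_refl A : SigmaP A -> SigmaP_Refl (FImp A (FEx (relz 0 (shift A)))).

Definition IKPP_Refl (A : form) : Prop := IKPP A \/ SigmaP_Refl A.

(* Main.v *)
(** The only new instances of reflection are those for implications: from
    [C -> A] with [C] a Pi^P- and [A] a Sigma^P-formula one must get one set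
    [w] with [C^w -> A^w]. They are made true by forcing with Pi^P-conditions.

    Fix the finitely many formulas reflected in a given derivation and a bounded
    formula [U(y, s)] whose sections [U(., s)] enumerate the families
    [y |-> B^y], for [B] a subformula of one of them. A condition is a set [p]
    of codes [s], standing for the class of all [p^w], where [p^w] says
    [U(y, s)] for all [s] in [p] and [y] in [w]. A bounded formula [B] is forced
    by [p] when [p^w -> B] for some [w]; bounded collection makes this
    compatible with all bounded connectives. Disjunction and existence are read
    through the largest nucleus fixing the truth values
    "for some [w], [p^w] implies [U(z, k)] for some [z] in [w]". This nucleus is
    definable, so that set induction survives, although the theory lacks the
    collection needed to iterate explicit covers.

    Then [p] forces a Sigma^P-formula [A] iff [p^w -> A^w] for some [w], and a
    Pi^P-formula [C] iff for every [v] some [w] has [p^w -> C^v]; for [C -> A]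
    one adds the code of [C] to [p]. So reflection is forced, and a
    Sigma^P-sentence forced by the empty condition is true. All of this is
    carried out in the term model of IKP(P), with truth values in the contexts. *)

Require Import Defs.
From Stdlib Require Import List Lia PeanoNat FunctionalExtensionality.
Import ListNotations.

Local Obligation Tactic := idtac.

(** * Renamings, substitution and free variables *)

Definition scons {D : Type} (x : D) (r : nat -> D) : nat -> D :=
  fun n => match n with 0 => x | S m => r m end.
Infix ".:" := scons (at level 55, right associativity).

Lemma up_comp f g : (fun n => up f (up g n)) = up (fun n => f (g n)).
Proof. extensionality n; now destruct n. Qed.

Lemma up_id : up (fun n => n) = fun n => n.
Proof. extensionality n; now destruct n. Qed.

Lemma rename_comp A : forall f g, rename f (rename g A) = rename (fun n => f (g n)) A.
Proof.
  induction A; intros f g; simpl; rewrite ?IHA, ?IHA1, ?IHA2, ?up_comp; reflexivity.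
Qed.

Lemma rename_id A : rename (fun n => n) A = A.
Proof. induction A; simpl; rewrite ?up_id; congruence. Qed.

Lemma rename_up_shift f A : rename (up f) (shift A) = shift (rename f A).
Proof. unfold shift; now rewrite !rename_comp. Qed.

Lemma rename_subst0 f t A : rename f (subst0 t A) = subst0 (f t) (rename (up f) A).
Proof.
  unfold subst0; rewrite !rename_comp; f_equal; extensionality n; now destruct n.
Qed.

Lemma subst0_up t r A : subst0 t (rename (up r) A) = rename (t .: r) A.
Proof.
  unfold subst0; rewrite rename_comp; f_equal; extensionality n; now destruct n.
Qed.

Lemma Delta0P_rename A : forall f, Delta0P A -> Delta0P (rename f A).
Proof. induction A; simpl; intuition. Qed.

Lemma closed_at_mono A : forall n m, n <= m -> closed_at n A -> closed_at m A.
Proof.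
  induction A; simpl; intros m k L H; intuition (eauto; try lia);
    eapply IHA; try eassumption; lia.
Qed.

Lemma closed_at_exists A : exists n, closed_at n A.
Proof.
  assert (two : forall B C, (exists n, closed_at n B) -> (exists n, closed_at n C) ->
            exists n, closed_at n B /\ closed_at n C).
  { intros B C [n Hn] [m Hm]; exists (n + m); split;
      eapply closed_at_mono; try eassumption; lia. }
  assert (one : forall i B, (exists n, closed_at n B) ->
            exists n, i < n /\ closed_at (S n) B).
  { intros i B [n Hn]; exists (S (n + i)); split; [lia|].
    eapply closed_at_mono; try eassumption; lia. }
  induction A; simpl; auto; try (now exists 0).
  - exists (S (n + n0)); lia.
  - destruct (one 0 A IHA) as [n [_ H]]; eauto.
  - destruct (one 0 A IHA) as [n [_ H]]; eauto.
Qed.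

Lemma closed_at_exists_list G : exists n, forall A, In A G -> closed_at n A.
Proof.
  induction G as [|A G [n Hn]]; [exists 0; easy|].
  destruct (closed_at_exists A) as [m Hm]; exists (n + m); intros B [<-|HB].
  - eapply closed_at_mono; try eassumption; lia.
  - eapply closed_at_mono; [|eapply Hn; eassumption]; lia.
Qed.

Lemma closed_at_rename_ext A : forall n f g, closed_at n A ->
  (forall i, i < n -> f i = g i) -> rename f A = rename g A.
Proof.
  assert (ups : forall n f g, (forall i, i < n -> f i = g i) ->
            forall i, i < S n -> up f i = up g i).
  { intros n f g H [|i] L; simpl; [easy|]; f_equal; apply H; lia. }
  induction A; simpl; intros m f g H E; f_equal;
    try (now apply E); try (now apply E, H); intuition eauto.
Qed.

(** * Weakening, renaming and fresh variables in derivations *)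

Lemma prv_weaken T G A : prv T G A -> forall G', incl G G' -> prv T G' A.
Proof.
  induction 1; intros G' I.
  - apply P_Ctx; auto.
  - now apply P_Ax.
  - now apply P_Bq.
  - apply P_BotE; auto.
  - apply P_ImpI, IHprv. apply incl_cons; [now left|]; now apply incl_tl.
  - eapply P_ImpE; eauto.
  - apply P_AndI; auto.
  - eapply P_AndE1; eauto.
  - eapply P_AndE2; eauto.
  - apply P_OrI1; auto.
  - apply P_OrI2; auto.
  - eapply P_OrE; [eauto| |]; [apply IHprv2|apply IHprv3];
      (apply incl_cons; [now left|]; now apply incl_tl).
  - apply P_AllI, IHprv. now apply incl_map.
  - apply P_AllE; auto.
  - eapply P_ExI; eauto.
  - eapply P_ExE; [eauto|]. apply IHprv2.
    apply incl_cons; [now left|]. now apply incl_tl, incl_map.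
Qed.

Definition rename_closed (T : form -> Prop) := forall f A, T A -> T (rename f A).

Lemma bq_axiom_rename : rename_closed bq_axiom.
Proof. intros f A []; simpl; constructor. Qed.

Lemma map_rename_shift f G :
  map (rename (up f)) (map shift G) = map shift (map (rename f) G).
Proof. rewrite !map_map; apply map_ext; intros; apply rename_up_shift. Qed.

Lemma prv_rename T G A : rename_closed T ->
  prv T G A -> forall f, prv T (map (rename f) G) (rename f A).
Proof.
  intros TR; induction 1; intros f; simpl in *.
  - apply P_Ctx. now apply in_map.
  - apply P_Ax. now apply TR.
  - apply P_Bq. now apply bq_axiom_rename.
  - apply P_BotE; apply IHprv.
  - apply P_ImpI, IHprv.
  - eapply P_ImpE; [apply IHprv1|apply IHprv2].
  - apply P_AndI; auto.
  - eapply P_AndE1; apply IHprv.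
  - eapply P_AndE2; apply IHprv.
  - apply P_OrI1; auto.
  - apply P_OrI2; auto.
  - eapply P_OrE; [apply IHprv1|apply IHprv2|apply IHprv3].
  - apply P_AllI. rewrite <- map_rename_shift; apply IHprv.
  - rewrite rename_subst0. apply P_AllE, IHprv.
  - apply P_ExI with (f t). rewrite <- rename_subst0; apply IHprv.
  - eapply P_ExE; [apply IHprv1|].
    rewrite <- map_rename_shift, <- rename_up_shift; apply IHprv2.
Qed.

Lemma IKPP_rename : rename_closed IKPP.
Proof.
  intros f A [].
  - simpl. rewrite !rename_subst0. apply (ax_ext _ (f a) (f b)).
    now apply Delta0P_rename.
  - apply (ax_pair (f a) (f b)).
  - apply (ax_union (f a)).
  - apply ax_inf.
  - simpl. replace (rename (up (up f)) (rename (up S) B))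
      with (rename (up S) (rename (up f) B)).
    + apply (ax_sep _ (f a)). now apply Delta0P_rename.
    + rewrite !rename_comp, !up_comp; reflexivity.
  - simpl. replace (rename (up (up (up f))) (rename (up (up S)) B))
      with (rename (up (up S)) (rename (up (up f)) B)).
    + apply (ax_coll _ (f a)). now apply Delta0P_rename.
    + rewrite !rename_comp, !up_comp; reflexivity.
  - simpl. replace (rename (up (up f)) (rename (up S) C))
      with (rename (up S) (rename (up f) C)).
    + apply ax_ind.
    + rewrite !rename_comp, !up_comp; reflexivity.
  - apply (ax_pow (f a)).
Qed.

(* Fresh variables play the role of generic elements. *)
Lemma prv_fresh_all T G A : rename_closed T ->
  (forall n, prv T G (subst0 n A)) -> prv T G (FAll A).
Proof.
  intros TR H.
  destruct (closed_at_exists_list (A :: G)) as [n Hn].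
  (* The index [n] is fresh for [G] and [A]. The renaming [f] turns it into the eigenvariable 0 and
     shifts every other index, so it maps the instance of [A] at [n] back to [A] and [G] to
     [map shift G]. *)
  set (f := fun m => if Nat.eqb m n then 0 else S m).
  assert (Hf : forall m, m < n -> f m = S m).
  { intros m L; unfold f. destruct (Nat.eqb_spec m n); [lia|easy]. }
  pose proof (prv_rename _ _ _ TR (H n) f) as P.
  apply P_AllI.
  replace (map shift G) with (map (rename f) G).
  2:{ apply map_ext_in; intros B HB. unfold shift.
      eapply closed_at_rename_ext; [apply Hn; now right|]; auto. }
  replace A with (rename f (subst0 n A)); [easy|].
  unfold subst0; rewrite rename_comp. rewrite <- (rename_id A) at 2.
  eapply closed_at_rename_ext; [apply Hn; now left|].
  intros [|m] L; unfold f at 1.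
  - now rewrite Nat.eqb_refl.
  - destruct (Nat.eqb_spec m n); [lia|easy].
Qed.

(** The instances at all variables give the universal closure of [A -> B]; instantiating it at the
    eigenvariable of [P_ExE] yields [B] there. *)
Lemma prv_fresh_ex T G A B : rename_closed T -> prv T G (FEx A) ->
  (forall n, prv T (subst0 n A :: G) B) -> prv T G B.
Proof.
  intros TR HE H. eapply P_ExE; [exact HE|].
  eapply P_ImpE with A; [|apply P_Ctx; now left].
  apply prv_weaken with (map shift G); [|now apply incl_tl, incl_refl].
  assert (P : prv T G (FAll (FImp A (shift B)))).
  { apply prv_fresh_all; [easy|]. intros n.
    unfold subst0; simpl. apply P_ImpI.
    replace (rename _ (shift B)) with B; [apply H|].
    unfold shift; rewrite rename_comp. symmetry; apply rename_id. }
  apply (fun Q => prv_rename _ _ _ TR Q S) in P. simpl in P.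
  apply P_AllE with (t := 0) in P. unfold subst0 in P; simpl in P.
  rewrite rename_comp in P.
  replace (rename _ A) with A in P.
  2:{ rewrite <- (rename_id A) at 1. f_equal. extensionality n; now destruct n. }
  replace (rename _ (rename _ _)) with (shift B) in P; [exact P|].
  unfold shift; rewrite !rename_comp; reflexivity.
Qed.

(** * Upsets closed under a nucleus as truth values *)

Record beth : Type := Beth {
  world : Type;
  le : world -> world -> Prop;
  le_refl : forall w, le w w;
  le_trans : forall u v w, le u v -> le v w -> le u w;
  goal : Type;
  meets : goal -> world -> Prop;
  meets_mono : forall k v w, le v w -> meets k v -> meets k w }.
Arguments le {_}. Arguments meets {_}. Arguments le_refl {_}. Arguments le_trans {_}.
Arguments meets_mono {_}.

(* The largest nucleus on the upsets that fixes every [meets k]. *)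
Definition jcl {b : beth} (X : world b -> Prop) (w : world b) : Prop :=
  forall k v, le w v -> (forall u, le v u -> X u -> meets k u) -> meets k v.

(** The fixed points of the nucleus form a complete Heyting algebra. Conjunction, implication and
    universal quantification are computed as for upsets; only falsity, disjunction and existence
    need to be closed under [jcl]. *)
Record tv (b : beth) : Type := Tv {
  holds :> world b -> Prop;
  holds_mono : forall v w, le v w -> holds v -> holds w;
  holds_jcl : forall w, jcl holds w -> holds w }.
Arguments holds {_}. Arguments holds_mono {_}. Arguments holds_jcl {_}.

Section Operations.
Context {b : beth}.
Implicit Types (X Y Z : tv b) (u v w : world b).

Program Definition hjcl (P : world b -> Prop) : tv b := Tv b (jcl P) _ _.
Next Obligation.
  intros P v w L H k u Lu Hk. apply H; [eapply le_trans; eauto|easy].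
Qed.
Next Obligation.
  intros P w H k v L Hk. apply H; [easy|]. intros u Lu Hu.
  apply Hu; [apply le_refl|]. intros t Lt. apply Hk. eapply le_trans; eauto.
Qed.

Lemma jcl_intro (P : world b -> Prop) w : (forall v, le w v -> P v) -> jcl P w.
Proof.
  intros H k v L Hk. apply Hk; [apply le_refl|]. now apply H.
Qed.

(** The nucleus mentions only the goals [meets k] as conclusions, but any closed [Z] will do: a goal
    that follows from [Z] follows from [P], and [holds_jcl] for [Z] does the rest. *)
Lemma jcl_elim (P : world b -> Prop) Z w :
  jcl P w -> (forall v, le w v -> P v -> Z v) -> Z w.
Proof.
  intros H HZ. apply holds_jcl. intros k v L Hk. apply H; [easy|].
  intros u Lu Pu. apply Hk; [easy|]. apply HZ; [eapply le_trans; eauto|easy].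
Qed.

Program Definition hand X Y : tv b := Tv b (fun w => X w /\ Y w) _ _.
Next Obligation. intros X Y v w L [H1 H2]; split; eapply holds_mono; eauto. Qed.
Next Obligation.
  intros X Y w H; split; apply (jcl_elim _ _ _ H); intros v _ [H1 H2]; assumption.
Qed.

Program Definition himp X Y : tv b :=
  Tv b (fun w => forall v, le w v -> X v -> Y v) _ _.
Next Obligation. intros X Y v w L H u Lu; apply H; eapply le_trans; eauto. Qed.
Next Obligation.
  intros X Y w H v L Xv. eapply jcl_elim.
  - exact (holds_mono (hjcl _) _ _ L H).
  - cbn; intros u Lu Hu. apply Hu; [apply le_refl|]. eapply holds_mono; eauto.
Qed.

Program Definition hall {D : Type} (f : D -> tv b) : tv b :=
  Tv b (fun w => forall x, f x w) _ _.
Next Obligation. intros D f v w L H x; eapply holds_mono; eauto. Qed.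
Next Obligation. intros D f w H x. apply (jcl_elim _ _ _ H); auto. Qed.

(** Falsity holds where every goal is met, so it need not be the empty upset; in the term model
    these worlds are the inconsistent contexts. *)
Definition hbot : tv b := hjcl (fun _ => False).
Definition hor X Y : tv b := hjcl (fun w => X w \/ Y w).
Definition hex {D : Type} (f : D -> tv b) : tv b := hjcl (fun w => exists x, f x w).

Lemma hbot_elim Z w : hbot w -> Z w.
Proof. intros H; apply (jcl_elim _ _ _ H); easy. Qed.

Lemma hor_intro1 X Y w : X w -> hor X Y w.
Proof. intros H; apply jcl_intro; left; eapply holds_mono; eauto. Qed.

Lemma hor_intro2 X Y w : Y w -> hor X Y w.
Proof. intros H; apply jcl_intro; right; eapply holds_mono; eauto. Qed.

Lemma hor_elim X Y w : hor X Y w -> forall Z,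
  (forall v, le w v -> X v -> Z v) -> (forall v, le w v -> Y v -> Z v) -> Z w.
Proof. intros H Z H1 H2; apply (jcl_elim _ _ _ H). intros v L [|]; auto. Qed.

Lemma hex_intro {D} (f : D -> tv b) x w : f x w -> hex f w.
Proof. intros H; apply jcl_intro; exists x; eapply holds_mono; eauto. Qed.

Lemma hex_elim {D} (f : D -> tv b) w : hex f w -> forall Z,
  (forall x v, le w v -> f x v -> Z v) -> Z w.
Proof. intros H Z HZ; apply (jcl_elim _ _ _ H). intros v L [x Hx]; eauto. Qed.

End Operations.

Arguments hand : simpl never. Arguments himp : simpl never.
Arguments hall : simpl never. Arguments hex : simpl never.
Arguments hbot : simpl never. Arguments hor : simpl never.

(** * Evaluation of formulas and soundness of natural deduction *)

Section Semantics.
Context {b : beth} {D : Type} (mem : D -> D -> tv b).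

Definition hincl x y := hall (fun z => himp (mem z x) (mem z y)).
Definition hball a (f : D -> tv b) := hall (fun x => himp (mem x a) (f x)).
Definition hbex a (f : D -> tv b) := hex (fun x => hand (mem x a) (f x)).
Definition hsall a (f : D -> tv b) := hall (fun x => himp (hincl x a) (f x)).
Definition hsex a (f : D -> tv b) := hex (fun x => hand (hincl x a) (f x)).

Fixpoint eval (A : form) (r : nat -> D) : tv b :=
  match A with
  | FIn i j => mem (r i) (r j)
  | FBot => hbot
  | FAnd B C => hand (eval B r) (eval C r)
  | FOr B C => hor (eval B r) (eval C r)
  | FImp B C => himp (eval B r) (eval C r)
  | FAll B => hall (fun x => eval B (x .: r))
  | FEx B => hex (fun x => eval B (x .: r))
  | FBAll i B => hball (r i) (fun x => eval B (x .: r))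
  | FBEx i B => hbex (r i) (fun x => eval B (x .: r))
  | FSAll i B => hsall (r i) (fun x => eval B (x .: r))
  | FSEx i B => hsex (r i) (fun x => eval B (x .: r))
  end.

Lemma scons_up {E} (x : E) r f : (fun n => (x .: r) (up f n)) = x .: (fun n => r (f n)).
Proof. extensionality n; now destruct n. Qed.

Lemma eval_rename A : forall f r, eval (rename f A) r = eval A (fun n => r (f n)).
Proof.
  induction A; intros f r; simpl; rewrite ?IHA1, ?IHA2; try reflexivity;
    f_equal; extensionality x; now rewrite IHA, (scons_up x r f).
Qed.

Lemma eval_shift A x r : eval (shift A) (x .: r) = eval A r.
Proof. unfold shift; now rewrite eval_rename. Qed.

Lemma eval_subst0 t A r : eval (subst0 t A) r = eval A (r t .: r).
Proof.
  unfold subst0; rewrite eval_rename; f_equal; extensionality n; now destruct n.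
Qed.

Lemma eval_closed_at A : forall n r s, closed_at n A ->
  (forall i, i < n -> r i = s i) -> eval A r = eval A s.
Proof.
  assert (ups : forall n r s (x : D), (forall i, i < n -> r i = s i) ->
            forall i, i < S n -> (x .: r) i = (x .: s) i).
  { intros n r s x H [|i] L; simpl; [easy|]; apply H; lia. }
  induction A; simpl; intros m r s H E; f_equal;
    try (extensionality x); try (now apply E); try (now apply E, H);
    intuition eauto.
Qed.

Lemma bq_axiom_valid A : bq_axiom A -> forall r w, eval A r w.
Proof. intros [] r w; split; intros v L H; exact H. Qed.

Theorem soundness T G A : (forall B, T B -> forall r w, eval B r w) ->
  prv T G A -> forall r w, (forall B, In B G -> eval B r w) -> eval A r w.
Proof.
  intros HT; induction 1; intros r w HG; simpl in *.
  - auto.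
  - now apply HT.
  - now apply bq_axiom_valid.
  - apply hbot_elim. exact (IHprv r w HG).
  - intros v L HA. apply IHprv. intros C [<-|HC]; [easy|].
    eapply holds_mono; eauto.
  - apply (IHprv1 r w HG w (le_refl w)); auto.
  - split; auto.
  - now apply (IHprv r w HG).
  - now apply (IHprv r w HG).
  - apply hor_intro1; auto.
  - apply hor_intro2; auto.
  - apply (hor_elim _ _ _ (IHprv1 r w HG)); intros v L HA;
      [apply IHprv2|apply IHprv3]; intros E [<-|HE]; try easy;
      eapply holds_mono; eauto.
  - intros x. apply IHprv. intros B HB.
    apply in_map_iff in HB as [C [<- HC]]. rewrite eval_shift; auto.
  - rewrite eval_subst0. apply (IHprv r w HG).
  - eapply hex_intro. rewrite <- eval_subst0; eauto.
  - apply (hex_elim _ _ (IHprv1 r w HG)). intros x v L HA.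
    rewrite <- (eval_shift B x r). apply IHprv2. intros C [<-|HC]; [easy|].
    apply in_map_iff in HC as [E [<- HE]]. rewrite eval_shift.
    eapply holds_mono; eauto.
Qed.

End Semantics.

(** * The term model, where truth at a context is derivability from it *)

Section TermModel.
Variables (T : form -> Prop) (TR : rename_closed T).

(** Since every formula is a goal, the nucleus quantifies over all possible conclusions of an
    elimination rule; this is what matches disjunction and existence with derivability. *)
Definition term_beth : beth := {|
  world := list form;
  le := @incl form;
  le_refl := @incl_refl form;
  le_trans := @incl_tran form;
  goal := form;
  meets B G := prv T G B;
  meets_mono B G G' I P := prv_weaken T G B P G' I |}.

Program Definition prv_tv (A : form) : tv term_beth :=
  Tv term_beth (fun G => prv T G A) _ _.
Next Obligation. intros A G G' I P. exact (prv_weaken _ _ _ P _ I). Qed.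
Next Obligation.
  intros A G H. apply (H A); [apply incl_refl|]; auto.
Qed.

Definition term_mem (i j : nat) : tv term_beth := prv_tv (FIn i j).

Lemma prv_imp G A B : prv T G (FImp A B) <->
  (forall G', incl G G' -> prv T G' A -> prv T G' B).
Proof.
  split.
  - intros H G' I HA. eapply P_ImpE; [|exact HA]. eapply prv_weaken; eauto.
  - intros H. apply P_ImpI, H; [now apply incl_tl, incl_refl|]. apply P_Ctx; now left.
Qed.

Lemma prv_all G A : prv T G (FAll A) <-> forall n, prv T G (subst0 n A).
Proof.
  split; [intros H n; now apply P_AllE|]. now apply prv_fresh_all.
Qed.

Lemma prv_ex G A : prv T G (FEx A) <->
  @hex term_beth _ (fun n => prv_tv (subst0 n A)) G.
Proof.
  split.
  - intros H B G' I HB. eapply prv_fresh_ex with (A := A); [easy| |].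
    + eapply prv_weaken; eauto.
    + intros n. apply HB; [now apply incl_tl, incl_refl|].
      exists n. apply P_Ctx; now left.
  - intros H. apply (hex_elim _ _ H (prv_tv (FEx A))).
    intros n G' I HA. now apply P_ExI with n.
Qed.

Lemma prv_iff G A B : prv T G (FIff A B) -> prv T G A <-> prv T G B.
Proof.
  intros H; split; intros P; (eapply P_ImpE; [|exact P]);
    [eapply P_AndE1|eapply P_AndE2]; exact H.
Qed.

(** Induction on [A]: the clauses of [eval] match the introduction and elimination rules, and
    bounded quantifiers are unfolded by [bq_axiom]. This turns arguments carried out inside the
    model into derivations. *)
Lemma eval_iff_prv A : forall r G, eval term_mem A r G <-> prv T G (rename r A).
Proof.
  assert (imp : forall (X Y : tv term_beth) B C,
    (forall G, X G <-> prv T G B) -> (forall G, Y G <-> prv T G C) ->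
    forall G, himp X Y G <-> prv T G (FImp B C)).
  { intros X Y B C HX HY G; rewrite prv_imp; split; intros H G' I; simpl in *;
      intros Q; apply HY, H, HX; easy. }
  assert (conj : forall (X Y : tv term_beth) B C,
    (forall G, X G <-> prv T G B) -> (forall G, Y G <-> prv T G C) ->
    forall G, hand X Y G <-> prv T G (FAnd B C)).
  { intros X Y B C HX HY G; split.
    - intros [H1 H2]; apply P_AndI; [now apply HX|now apply HY].
    - intros H; split; [apply HX; eapply P_AndE1|apply HY; eapply P_AndE2]; eauto. }
  assert (all : forall (f : nat -> tv term_beth) B,
    (forall n G, f n G <-> prv T G (subst0 n B)) ->
    forall G, hall f G <-> prv T G (FAll B)).
  { intros f B Hf G; rewrite prv_all; split; intros H n; now apply Hf. }
  assert (ex : forall (f : nat -> tv term_beth) B,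
    (forall n G, f n G <-> prv T G (subst0 n B)) ->
    forall G, hex f G <-> prv T G (FEx B)).
  { intros f B Hf G; rewrite prv_ex; split; intros H; apply (hex_elim _ _ H);
      intros n G' I Hn; apply hex_intro with n; now apply Hf. }
  assert (bq : forall G B C, bq_axiom (FIff B C) -> prv T G B <-> prv T G C).
  { intros G B C H. now apply prv_iff, P_Bq. }
  assert (mem : forall i j G, term_mem i j G <-> prv T G (FIn i j)) by reflexivity.
  assert (sub : forall i j G, hincl term_mem i j G <-> prv T G (FSub i j)).
  { intros i j G. unfold FSub. rewrite (bq G _ _ (bq_BAll _ _)).
    apply all. intros n; apply imp; apply mem. }
  induction A; intros r G; cbn [eval rename]; unfold hball, hbex, hsall, hsex.
  - apply mem.
  - split; [intros H; now apply (hbot_elim (prv_tv FBot) G)|].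
    intros H B G' I _. apply P_BotE. eapply prv_weaken; eauto.
  - now apply conj.
  - split.
    + intros H. change (prv_tv (FOr (rename r A1) (rename r A2)) G).
      apply (hor_elim _ _ _ H); intros G' I HA.
      * apply P_OrI1, IHA1; exact HA.
      * apply P_OrI2, IHA2; exact HA.
    + intros H B G' I HB. eapply P_OrE; [eapply prv_weaken; eauto| |]; apply HB;
        try (now apply incl_tl, incl_refl); [left; apply IHA1|right; apply IHA2];
        apply P_Ctx; now left.
  - now apply imp.
  - apply all. intros n G'. rewrite subst0_up. apply IHA.
  - apply ex. intros n G'. rewrite subst0_up. apply IHA.
  - rewrite (bq G _ _ (bq_BAll _ _)). apply all. intros k; apply imp; [apply mem|].
    intros G'. rewrite IHA, <- subst0_up. reflexivity.
  - rewrite (bq G _ _ (bq_BEx _ _)). apply ex. intros k; apply conj; [apply mem|].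
    intros G'. rewrite IHA, <- subst0_up. reflexivity.
  - rewrite (bq G _ _ (bq_SAll _ _)). apply all. intros k; apply imp; [apply sub|].
    intros G'. rewrite IHA, <- subst0_up. reflexivity.
  - rewrite (bq G _ _ (bq_SEx _ _)). apply ex. intros k; apply conj; [apply sub|].
    intros G'. rewrite IHA, <- subst0_up. reflexivity.
Qed.

Lemma term_model_valid A r G : T A -> eval term_mem A r G.
Proof. intros H; apply eval_iff_prv, P_Ax. now apply TR. Qed.

End TermModel.

(** * Set theory inside a model *)

(* Entering a later world transports all hypotheses there, so that reasoning
   inside a model reads like an ordinary intuitionistic proof. *)
Ltac up_along L :=
  repeat match goal with H : holds ?X ?w |- _ =>
    match type of L with le w ?v => apply (holds_mono X w v L) in H end end.
Tactic Notation "hintro" ident(H) :=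
  let v := fresh "w" in let L := fresh "Hle" in intros v L H; up_along L.
Tactic Notation "hdestruct" constr(H) "as" ident(x) simple_intropattern(p) :=
  let v := fresh "w" in let L := fresh "Hle" in let H' := fresh "H" in
  apply (hex_elim _ _ H); try clear H; intros x v L H'; up_along L; revert H'; intros p.
Tactic Notation "hcases" constr(H) "as" ident(H1) :=
  apply (hor_elim _ _ _ H); hintro H1.

Definition hiff {b : beth} (X Y : tv b) := hand (himp X Y) (himp Y X).

Section SetTheory.
Context {b : beth} {D : Type} (mem : D -> D -> tv b).
Hypothesis valid : forall A, IKPP A -> forall r w, eval mem A r w.
Implicit Types (r : nat -> D) (w : world b).

Notation ev := (eval mem). Notation hsub := (hincl mem).
Notation ball := (hball mem). Notation bex := (hbex mem). Notation sall := (hsall mem).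

Definition heq x y := hand (hsub x y) (hsub y x).

(** Truth values, predicates and relations given by bounded formulas with parameters. Separation and
    collection are stated for these, which keeps variable indices out of the set-theoretic
    arguments. *)
Definition def0 (X : tv b) := exists B r, Delta0P B /\ X = ev B r.
Definition def1 (P : D -> tv b) :=
  exists B r, Delta0P B /\ forall x, P x = ev B (x .: r).
Definition def2 (P : D -> D -> tv b) :=
  exists B r, Delta0P B /\ forall x y, P x y = ev B (x .: y .: r).

Definition hmono (P : D -> tv b) := forall u v w, hsub u v w -> P u w -> P v w.

Lemma apply_imp {X Y : tv b} {w} : himp X Y w -> X w -> Y w.
Proof. intros H; apply H, le_refl. Qed.

Lemma hsub_refl x w : hsub x x w.
Proof. intros z; hintro H; exact H. Qed.

Lemma hsub_trans x y z w : hsub x y w -> hsub y z w -> hsub x z w.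
Proof.
  intros H1 H2 u; hintro H. exact (apply_imp (H2 u) (apply_imp (H1 u) H)).
Qed.

Lemma hsub_mem {x y z w} : hsub x y w -> mem z x w -> mem z y w.
Proof. intros H; apply (apply_imp (H z)). Qed.

Lemma heq_refl x w : heq x x w.
Proof. split; apply hsub_refl. Qed.

Lemma heq_sym x y w : heq x y w -> heq y x w.
Proof. intros [H1 H2]; split; assumption. Qed.

Lemma heq_trans x y z w : heq x y w -> heq y z w -> heq x z w.
Proof. intros [H1 H2] [H3 H4]; split; eapply hsub_trans; eassumption. Qed.

Lemma extensionality_def1 P x y w : def1 P -> heq x y w -> P x w -> P y w.
Proof.
  intros (B & r & HB & E) H HP. rewrite E in HP |- *.
  (* The parameters of [B] move up by two to make room for [x] and [y], to which the variables 0 and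
     1 of the axiom refer. *)
  pose proof (valid _ (ax_ext (rename (up (fun n => S (S n))) B) 0 1
     (Delta0P_rename _ _ HB)) (x .: y .: r) w) as V.
  assert (EV : forall z, ev (rename (up (fun n => S (S n))) B) (z .: x .: y .: r)
                         = ev B (z .: r)).
  { intros z; rewrite eval_rename; f_equal; extensionality n; now destruct n. }
  cbn [eval] in V. rewrite !eval_subst0 in V. cbn [scons] in V.
  rewrite !EV in V. exact (apply_imp V (conj H HP)).
Qed.

Lemma mem_heq x y z w : heq x y w -> mem x z w -> mem y z w.
Proof.
  apply (extensionality_def1 (fun x => mem x z)).
  exists (FIn 0 1), (fun _ => z); now split.
Qed.

Lemma pairing x y w : hex (fun z => hand (mem x z) (mem y z)) w.
Proof. exact (valid _ (ax_pair 0 1) (x .: fun _ => y) w). Qed.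

Lemma union x w : hex (fun z => ball x (fun y => hsub y z)) w.
Proof. exact (valid _ (ax_union 0) (fun _ => x) w). Qed.

Lemma power x w : hex (fun z => sall x (fun y => mem y z)) w.
Proof. exact (valid _ (ax_pow 0) (fun _ => x) w). Qed.

Lemma inhabited_domain (Z : tv b) r w : (D -> forall v, le w v -> Z v) -> Z w.
Proof.
  intros H. pose proof (valid _ ax_inf r w) as V.
  apply (hex_elim _ _ V). intros x v L _. exact (H x v L).
Qed.

Lemma separation x P w : def1 P ->
  hex (fun z => hall (fun y => hiff (mem y z) (hand (mem y x) (P y)))) w.
Proof.
  intros (B & r & HB & E).
  pose proof (valid _ (ax_sep (rename (up S) B) 0 (Delta0P_rename _ _ HB))
    (x .: r) w) as V. cbn [eval] in V.
  replace (fun z => hall (fun y => hiff (mem y z) (hand (mem y x) (P y)))) with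
    (fun z => hall (fun y => hiff (mem y z)
       (hand (mem y x) (ev (rename (up S) (rename (up S) B)) (y .: z .: x .: r))))).
  { exact V. }
  extensionality z. f_equal. extensionality y. do 2 f_equal.
  rewrite E, !eval_rename. f_equal. extensionality n; now destruct n.
Qed.

Lemma collection x P w : def2 P -> ball x (fun y => hex (fun z => P z y)) w ->
  hex (fun u => ball x (fun y => bex u (fun z => P z y))) w.
Proof.
  intros (B & r & HB & E) H.
  assert (EB : forall y z, P z y =
     ev (rename (up (up S)) B) (z .: y .: x .: r)).
  { intros y z; rewrite E, eval_rename; f_equal; extensionality n;
      destruct n as [|[|n]]; reflexivity. }
  pose proof (valid _ (ax_coll (rename (up (up S)) B) 0 (Delta0P_rename _ _ HB))
    (x .: r) w) as V. cbn [eval] in V.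
  match goal with |- holds ?X w => replace X with
    (hex (fun u => ball x (fun y => bex u (fun z =>
       ev (rename (up (up S)) (rename (up (up S)) B)) (z .: y .: u .: x .: r))))) end.
  { apply (apply_imp V). intros y; hintro Hy.
    pose proof (apply_imp (H y) Hy) as Q.
    refine (eq_ind _ (fun f => hex f _) Q _ _). extensionality z. apply EB. }
  f_equal; extensionality u; f_equal; extensionality y; f_equal; extensionality z.
  rewrite EB, (eval_rename _ (rename _ _)). f_equal. extensionality n.
  destruct n as [|[|n]]; reflexivity.
Qed.

Lemma set_induction C r w :
  hall (fun x => himp (ball x (fun y => ev C (y .: r))) (ev C (x .: r))) w ->
  hall (fun x => ev C (x .: r)) w.
Proof.
  intros H. pose proof (valid _ (ax_ind C) r w) as V. cbn [eval] in V.
  apply (apply_imp V). intros x; hintro Hx.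
  refine (apply_imp (H x) _). refine (eq_ind _ (fun f => ball x f _) Hx _ _).
  extensionality y. rewrite eval_rename. f_equal. extensionality n; now destruct n.
Qed.

Lemma union2 x y w : hex (fun z => hand (hsub x z) (hsub y z)) w.
Proof.
  hdestruct (pairing x y w) as u [H1 H2]. hdestruct (union u w0) as z Hz.
  apply hex_intro with z. split; [exact (apply_imp (Hz x) H1)|exact (apply_imp (Hz y) H2)].
Qed.

Lemma superset_adjoin x y w : hex (fun z => hand (hsub x z) (mem y z)) w.
Proof.
  hdestruct (pairing y y w) as u [H _]. hdestruct (union2 x u w0) as z [H1 H2].
  apply hex_intro with z. split; [easy|]. exact (hsub_mem H2 H).
Qed.

Lemma superset_union x w : hex (fun z => hand (hsub x z) (ball x (fun y => hsub y z))) w.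
Proof.
  hdestruct (union x w) as u Hu. hdestruct (union2 x u w0) as z [H1 H2].
  apply hex_intro with z. split; [easy|]. intros y; hintro Hy.
  eapply hsub_trans; [exact (apply_imp (Hu y) Hy)|easy].
Qed.

Lemma adjoin x y w :
  hex (fun z => hall (fun u => hiff (mem u z) (hor (mem u x) (heq u y)))) w.
Proof.
  hdestruct (superset_adjoin x y w) as t [Hx Hy].
  assert (Hd : def1 (fun u => hor (mem u x) (heq u y))).
  { exists (FOr (FIn 0 1) (FEq 0 2)), (x .: fun _ => y).
    split; [simpl; tauto|reflexivity]. }
  hdestruct (separation t _ w0 Hd) as z Hz.
  apply hex_intro with z. intros u; split; hintro H.
  - exact (proj2 (apply_imp (proj1 (Hz u)) H)).
  - apply (apply_imp (proj2 (Hz u))). split; [|easy].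
    hcases H as Hu; [exact (hsub_mem Hx Hu)|].
    eapply mem_heq; [apply heq_sym; eassumption|easy].
Qed.

Lemma empty_set r w : hex (fun z => hall (fun u => himp (mem u z) hbot)) w.
Proof.
  apply (inhabited_domain _ r). intros x v _.
  assert (Hd : def1 (fun _ => hbot)) by (exists FBot, r; split; easy).
  hdestruct (separation x _ v Hd) as z Hz.
  apply hex_intro with z. intros u; hintro Hu. exact (proj2 (apply_imp (proj1 (Hz u)) Hu)).
Qed.

Definition inh x := bex x (fun _ => himp hbot hbot).

(** Separating from an inhabited set by the constant predicate [X] gives the required [t]; bounded
    truth values thereby become sets. *)
Lemma truth_value X r w : def0 X -> hex (fun t => hiff (inh t) X) w.
Proof.
  intros (B & s & HB & E). apply (inhabited_domain _ r). intros x v _.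
  hdestruct (pairing x x v) as y [Hx _].
  assert (Hd : def1 (fun _ => X)).
  { exists (shift B), s. split; [now apply Delta0P_rename|].
    intros z; now rewrite eval_shift. }
  hdestruct (separation y _ w0 Hd) as t Ht. apply hex_intro with t. split; hintro H.
  - hdestruct H as z [Hz _]. exact (proj2 (apply_imp (proj1 (Ht z)) Hz)).
  - apply hex_intro with x. split; [|now hintro H'].
    apply (apply_imp (proj2 (Ht x))); now split.
Qed.

(** Monotonicity merges the collected witnesses into one: each of them is a subset of the union of
    the collecting set. *)
Lemma collection_mono x P w : def2 P -> (forall y, hmono (fun v => P v y)) ->
  ball x (fun y => hex (fun v => P v y)) w -> hex (fun v => ball x (fun y => P v y)) w.
Proof.
  intros Hd Hm H. hdestruct (collection x P w Hd H) as z Hz.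
  hdestruct (superset_union z w0) as v [_ Hv]. apply hex_intro with v.
  intros y; hintro Hy. hdestruct (apply_imp (Hz y) Hy) as u [Hu HP].
  apply (Hm y u v); [|easy]. exact (apply_imp (Hv u) Hu).
Qed.

(** An implication with bounded premise amounts to a quantifier over the set [t] that is inhabited
    exactly when [X] holds, so collection applies to it. *)
Lemma collection_imp X P r w : def0 X -> def1 P -> hmono P ->
  himp X (hex P) w -> hex (fun v => himp X (P v)) w.
Proof.
  intros HX (B & s & HB & E) Hm H. hdestruct (truth_value X r w HX) as t Ht.
  assert (Hd : def2 (fun v _ => P v)).
  { exists (rename (fun n => match n with 0 => 0 | S n => S (S n) end) B), s.
    split; [now apply Delta0P_rename|]. intros v y. rewrite E, eval_rename. f_equal.
    extensionality n; now destruct n. }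
  assert (HC : ball t (fun _ => hex P) w0).
  { intros y; hintro Hy. apply (apply_imp H). apply (apply_imp (proj1 Ht)).
    apply hex_intro with y. split; [easy|now hintro H']. }
  hdestruct (collection_mono t _ w0 Hd (fun _ => Hm) HC) as v Hv.
  apply hex_intro with v. hintro HX'.
  hdestruct (apply_imp (proj2 Ht) HX') as y [Hy _]. exact (apply_imp (Hv y) Hy).
Qed.

(** The power set, cut down by separation to the subsets of [x], turns the subset-bounded quantifier
    into one over elements. *)
Lemma collection_sub x P w : def2 P -> (forall y, hmono (fun v => P v y)) ->
  sall x (fun y => hex (fun v => P v y)) w -> hex (fun v => sall x (fun y => P v y)) w.
Proof.
  intros Hd Hm H. hdestruct (power x w) as z Hz.
  assert (Hs : def1 (fun y => hsub y x)).
  { exists (FSub 0 1), (fun _ => x). split; easy. }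
  hdestruct (separation z _ w0 Hs) as t Ht.
  assert (HC : ball t (fun y => hex (fun v => P v y)) w1).
  { intros y; hintro Hy. apply (apply_imp (H y)).
    exact (proj2 (apply_imp (proj1 (Ht y)) Hy)). }
  hdestruct (collection_mono t P w1 Hd Hm HC) as v Hv.
  apply hex_intro with v. intros y; hintro Hy. apply (apply_imp (Hv y)).
  apply (apply_imp (proj2 (Ht y))). split; [|easy]. exact (apply_imp (Hz y) Hy).
Qed.

(** * Kuratowski pairs and their injectivity *)

Definition usingle u x := hand (mem x u) (ball u (fun z => heq z x)).
Definition upair u x y :=
  hand (mem x u) (hand (mem y u) (ball u (fun z => hor (heq z x) (heq z y)))).
Definition opair s x y :=
  hand (bex s (fun u => usingle u x)) (hand (bex s (fun u => upair u x y))
    (ball s (fun u => hor (usingle u x) (upair u x y)))).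

Lemma exists_upair x y w : hex (fun u => upair u x y) w.
Proof.
  hdestruct (pairing x y w) as t [Hx Hy].
  assert (Hd : def1 (fun u => hor (heq u x) (heq u y))).
  { exists (FOr (FEq 0 1) (FEq 0 2)), (x .: fun _ => y).
    split; [simpl; tauto|reflexivity]. }
  hdestruct (separation t _ w0 Hd) as u Hu. apply hex_intro with u.
  split; [|split].
  - apply (apply_imp (proj2 (Hu x))). split; [easy|]. apply hor_intro1, heq_refl.
  - apply (apply_imp (proj2 (Hu y))). split; [easy|]. apply hor_intro2, heq_refl.
  - intros z; hintro Hz. exact (proj2 (apply_imp (proj1 (Hu z)) Hz)).
Qed.

Lemma exists_opair x y w : hex (fun s => opair s x y) w.
Proof.
  hdestruct (exists_upair x x w) as u Hu. hdestruct (exists_upair x y w0) as v Hv.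
  hdestruct (exists_upair u v w1) as s [Hs1 [Hs2 Hs3]].
  assert (Hu' : usingle u x w2).
  { destruct Hu as [H1 [_ H2]]; split; [easy|]. intros z; hintro Hz.
    hcases (apply_imp (H2 z) Hz) as H; exact H. }
  apply hex_intro with s. split; [|split].
  - apply hex_intro with u; now split.
  - apply hex_intro with v; now split.
  - intros t; hintro Ht. hcases (apply_imp (Hs3 t) Ht) as H.
    + apply hor_intro1. apply (extensionality_def1 (fun t => usingle t x) u); [| |easy].
      * exists (FAnd (FIn 1 0) (FBAll 0 (FEq 0 2))), (fun _ => x).
        split; [simpl; tauto|reflexivity].
      * now apply heq_sym.
    + apply hor_intro2. apply (extensionality_def1 (fun t => upair t x y) v); [| |easy].
      * exists (FAnd (FIn 1 0) (FAnd (FIn 2 0) (FBAll 0 (FOr (FEq 0 2) (FEq 0 3))))),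
          (x .: fun _ => y). split; [simpl; tauto|reflexivity].
      * now apply heq_sym.
Qed.

(** The singleton [u] in [s] has only [x] as element, while either description of [u] through [x']
    and [y'] puts [x'] into it. *)
Lemma opair_inj1 s x y x' y' w : opair s x y w -> opair s x' y' w -> heq x x' w.
Proof.
  intros [H _] [_ [_ H']]. hdestruct H as u [Hu [_ Hx]].
  hcases (apply_imp (H' u) Hu) as E.
  - apply heq_sym, (apply_imp (Hx x')), E.
  - apply heq_sym, (apply_imp (Hx x')), E.
Qed.

Lemma opair_inj2 s x y x' y' w : opair s x y w -> opair s x' y' w -> heq y y' w.
Proof.
  intros H H'. pose proof (opair_inj1 _ _ _ _ _ _ H H') as Ex.
  (* Equality is not decidable, so the second component is first only located: it equals the first
     component or the other second component. Using this in both directions settles the remaining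
     case. *)
  assert (K : forall a c a' c' v, opair s a c v -> opair s a' c' v -> heq a a' v ->
            hor (heq c a) (heq c c') v).
  { intros a c a' c' v [_ [K _]] [_ [_ K']] Ea. hdestruct K as u [Hu [_ [Hc _]]].
    hcases (apply_imp (K' u) Hu) as Q.
    - apply hor_intro1. apply heq_trans with a'; [|now apply heq_sym].
      exact (apply_imp (proj2 Q c) Hc).
    - hcases (apply_imp (proj2 (proj2 Q) c) Hc) as E.
      + apply hor_intro1. apply heq_trans with a'; [easy|now apply heq_sym].
      + now apply hor_intro2. }
  hcases (K _ _ _ _ _ H H' Ex) as E; [|easy].
  hcases (K _ _ _ _ _ H' H (heq_sym _ _ _ Ex)) as E'; [|now apply heq_sym].
  eapply heq_trans; [exact E|]. eapply heq_trans; [exact Ex|]. now apply heq_sym.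
Qed.

End SetTheory.

(** * A universal bounded formula *)

Section Universal.
Context {b : beth} {D : Type} (mem : D -> D -> tv b).
Hypothesis valid : forall A, IKPP A -> forall r w, eval mem A r w.
Implicit Types (r : nat -> D) (w : world b).
Notation ev := (eval mem). Notation ball := (hball mem).

(** All parameters of [U] are interpreted by the same set [s], which thus acts as the code of a
    section of [U]. *)
Definition family U y s := ev U (y .: fun _ => s).

Definition codes U s (P : D -> tv b) := hall (fun y => hiff (family U y s) (P y)).

Definition universal_for U A := forall r w, hex (fun s => codes U s (fun y => ev A (y .: r))) w.

Lemma codes_iff U s P Q w : (forall y v, le w v -> hiff (P y) (Q y) v) ->
  codes U s P w -> codes U s Q w.
Proof.
  intros H HP y. split; intros v L Hy.
  - apply (apply_imp (proj1 (H y v L))), (proj1 (HP y)); assumption.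
  - apply (proj2 (HP y)); [easy|]. exact (apply_imp (proj2 (H y v L)) Hy).
Qed.

(** The Kuratowski pair as a bounded formula, evaluated to [opair]. *)
Definition OPair s x y : form :=
  let Sing u x := FAnd (FIn x u) (FBAll u (FEq 0 (S x))) in
  let Pair u x y := FAnd (FIn x u) (FAnd (FIn y u)
                      (FBAll u (FOr (FEq 0 (S x)) (FEq 0 (S y))))) in
  FAnd (FBEx s (Sing 0 (S x))) (FAnd (FBEx s (Pair 0 (S x) (S y)))
    (FBAll s (FOr (Sing 0 (S x)) (Pair 0 (S x) (S y))))).

(* Under the binders u, x, v, z the variables are z v x u y s, in this order. *)
Definition unpair A : form :=
  FBAll 1 (FBAll 0 (FBAll 3 (FBAll 0 (FImp (OPair 5 2 0)
    (rename (fun n => match n with 0 => 4 | 1 => 2 | 2 => 0 | S (S (S n)) => 6 + n end) A))))).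

Lemma ev_unpair A r : ev (unpair A) r =
  ball (r 1) (fun u => ball u (fun x => ball (r 1) (fun v => ball v (fun z =>
    himp (opair mem (r 1) x z) (ev A (r 0 .: x .: z .: fun n => r (S (S n)))))))).
Proof.
  assert (E : (fun u x v z => ev (rename (fun n => match n with 0 => 4 | 1 => 2 | 2 => 0
      | S (S (S n)) => 6 + n end) A) (z .: v .: x .: u .: r)) =
    (fun u x v z => ev A (r 0 .: x .: z .: fun n => r (S (S n))))).
  { extensionality u; extensionality x; extensionality v; extensionality z.
    rewrite eval_rename; f_equal. extensionality n. destruct n as [|[|[|n]]]; reflexivity. }
  exact (f_equal (fun f => ball (r 1) (fun u => ball u (fun x => ball (r 1) (fun v =>
    ball v (fun z => himp (opair mem (r 1) x z) (f u x v z)))))) E).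
Qed.

(** Both components lie in elements of [s], so the bounded quantifiers of [unpair] reach them.
    Conversely, injectivity identifies every decoded pair with [x] and [z], and extensionality
    transports [A]. *)
Lemma unpair_iff A s x z y r w : Delta0P A -> opair mem s x z w ->
  hiff (ev (unpair A) (y .: s .: r)) (ev A (y .: x .: z .: r)) w.
Proof.
  intros HA Hs. split; rewrite ev_unpair; hintro H.
  - pose proof Hs as [_ [Hp _]]. hdestruct Hp as u [Hu [Hx [Hz _]]].
    refine (apply_imp (apply_imp (apply_imp (apply_imp (apply_imp (H u) Hu x) Hx u) Hu z) Hz) _).
    exact Hs.
  - intros u; hintro Hu. intros x'; hintro Hx. intros v; hintro Hv. intros z'; hintro Hz.
    hintro Hs'.
    pose proof (opair_inj1 _ _ _ _ _ _ _ Hs Hs') as Ex.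
    pose proof (opair_inj2 _ _ _ _ _ _ _ Hs Hs') as Ez.
    apply (extensionality_def1 _ valid (fun z => ev A (y .: x' .: z .: r)) z z');
      [|exact Ez|].
    (* The variable to be replaced is moved to position 0, as [def1] requires. *)
    { exists (rename (fun n => match n with 0 => 1 | 1 => 2 | 2 => 0 | S n => S n end) A).
      exists (y .: x' .: r). split; [now apply Delta0P_rename|]. intros t.
      rewrite eval_rename; f_equal; extensionality n; destruct n as [|[|[|n]]]; reflexivity. }
    apply (extensionality_def1 _ valid (fun x => ev A (y .: x .: z .: r)) x x');
      [|exact Ex|exact H].
    exists (rename (fun n => match n with 0 => 1 | 1 => 0 | S n => S n end) A).
    exists (y .: z .: r). split; [now apply Delta0P_rename|]. intros t.
    rewrite eval_rename; f_equal; extensionality n; destruct n as [|[|[|n]]]; reflexivity.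
Qed.

(* Pairing merges the parameters of a formula into one, two at a time. *)
Lemma exists_universal1 n : forall A, Delta0P A ->
  (forall r s, (forall i, i < S (S n) -> r i = s i) -> ev A r = ev A s) ->
  exists U, Delta0P U /\ universal_for U A.
Proof.
  induction n as [|n IH]; intros A HA Hd.
  (* With a single parameter, that parameter is its own code. *)
  - exists A. split; [easy|]. intros r w. apply hex_intro with (r 0). intros y.
    replace (ev A (y .: r)) with (family A y (r 0)).
    + split; now hintro H.
    + apply Hd. intros [|[|i]] Hi; try reflexivity; lia.
  - destruct (IH (unpair A)) as (U & HU & HUA).
    + simpl; repeat split. now apply Delta0P_rename.
    + intros r s H. rewrite !ev_unpair, !(H 0), !(H 1) by lia.
      f_equal; extensionality u; f_equal; extensionality x; f_equal; extensionality v;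
      f_equal; extensionality z; f_equal. apply Hd.
      intros [|[|[|i]]] Hi; try reflexivity. cbn. apply H; lia.
    + exists U. split; [easy|]. intros r w.
      hdestruct (exists_opair mem valid (r 0) (r 1) w) as t Ht.
      hdestruct (HUA (t .: fun n => r (S (S n))) w0) as s Hs. apply hex_intro with s.
      revert Hs. apply codes_iff. intros y v L'.
      replace (y .: r) with (y .: r 0 .: r 1 .: fun n => r (S (S n))).
      * apply unpair_iff; [easy|]. eapply holds_mono; eauto.
      * extensionality i; destruct i as [|[|[|i]]]; reflexivity.
Qed.

Lemma exists_universal (L : list form) : (forall A, In A L -> Delta0P A) ->
  exists U, Delta0P U /\ forall A, In A L -> universal_for U A.
Proof.
  induction L as [|A L IH]; intros HL; [exists FBot; simpl; tauto|].
  destruct IH as (U2 & HU2 & H2); [intros; apply HL; now right|].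
  destruct (closed_at_exists A) as [n Hn].
  destruct (exists_universal1 n A) as (U1 & HU1 & H1); [apply HL; now left| |].
  { intros r s H. apply (eval_closed_at mem A n); [easy|]. intros; apply H; lia. }
  (* The combined formula has two parameters, a code [s] and a switch [t]: inhabited [t] selects
     [U1], empty [t] selects [U2]. Implications express the selection, so [t] need not be decided.
     The renaming [f] lets all parameters of [U1] and [U2] read [s]. *)
  set (f := fun n => match n with 0 => 0 | _ => 1 end).
  set (I := FBEx 2 (FImp FBot FBot)).
  destruct (exists_universal1 1 (FAnd (FImp I (rename f U1)) (FImp (FNeg I) (rename f U2))))
    as (U & HU & HUI).
  { simpl; repeat split; now apply Delta0P_rename. }
  { intros r s H. cbn [eval I FNeg]. rewrite !eval_rename, (H 2) by lia.
    replace (fun n => r (f n)) with (fun n => s (f n)); [reflexivity|].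
    extensionality i; destruct i; cbn; symmetry; apply H; lia. }
  assert (HE : forall s t y r, ev (FAnd (FImp I (rename f U1)) (FImp (FNeg I) (rename f U2)))
    (y .: s .: t .: r) = hand (himp (inh mem t) (family U1 y s))
                      (himp (himp (inh mem t) hbot) (family U2 y s))).
  { intros s t y r. cbn [eval I FNeg]. unfold family. rewrite !eval_rename.
    replace (fun n => (y .: s .: t .: r) (f n)) with (y .: fun _ : nat => s);
      [reflexivity|]. extensionality i; now destruct i. }
  exists U. split; [easy|]. intros B [<-|HB] r w.
  - hdestruct (H1 r w) as s1 Hs1.
    assert (HT : def0 mem (himp hbot hbot)) by now exists (FImp FBot FBot), r.
    hdestruct (truth_value mem valid _ r w0 HT) as t Ht.
    hdestruct (HUI (s1 .: t .: r) w1) as s Hs. apply hex_intro with s.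
    revert Hs. apply codes_iff. intros y v L'. rewrite HE. up_along L'.
    assert (Hi : inh mem t v) by (apply (apply_imp (proj2 Ht)); now hintro H).
    split; hintro H.
    + exact (apply_imp (proj1 (Hs1 y)) (apply_imp (proj1 H) Hi)).
    + split; hintro H'; [exact (apply_imp (proj2 (Hs1 y)) H)|].
      apply hbot_elim. exact (apply_imp H' Hi).
  - hdestruct (H2 B HB r w) as s2 Hs2.
    hdestruct (empty_set mem valid r w0) as t Ht.
    hdestruct (HUI (s2 .: t .: r) w1) as s Hs. apply hex_intro with s.
    revert Hs. apply codes_iff. intros y v L'. rewrite HE. up_along L'.
    assert (Hi : himp (inh mem t) hbot v).
    { hintro H. hdestruct H as x [Hx _]. exact (apply_imp (Ht x) Hx). }
    split; hintro H.
    + exact (apply_imp (proj1 (Hs2 y)) (apply_imp (proj2 H) Hi)).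
    + split; hintro H'; [|exact (apply_imp (proj2 (Hs2 y)) H)].
      apply hbot_elim. exact (apply_imp Hi H').
Qed.

End Universal.

(** * Forcing *)

Section Definability.
Context {b : beth} {D : Type} (mem : D -> D -> tv b).
Implicit Types r : nat -> D.

Lemma def0_ev A r : Delta0P A -> def0 mem (eval mem A r).
Proof. now exists A, r. Qed.

Lemma def1_def2_fst P : def1 mem P -> def2 mem (fun x _ => P x).
Proof.
  intros (B & r & HB & E).
  exists (rename (fun n => match n with 0 => 0 | S n => S (S n) end) B), r.
  split; [now apply Delta0P_rename|]. intros x y. rewrite E, eval_rename. f_equal.
  extensionality n; now destruct n.
Qed.

Lemma def1_def2_snd P : def1 mem P -> def2 mem (fun _ y => P y).
Proof.
  intros (B & r & HB & E). exists (shift B), r.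
  split; [now apply Delta0P_rename|]. intros x y. now rewrite E, eval_shift.
Qed.

Lemma def0_def1 X : def0 mem X -> def1 mem (fun _ => X).
Proof.
  intros (B & r & HB & ->). exists (shift B), r.
  split; [now apply Delta0P_rename|]. intros x. now rewrite eval_shift.
Qed.

Lemma def2_def1 P : def2 mem (fun x _ => P x) -> D -> def1 mem P.
Proof.
  intros (B & r & HB & E) y.
  exists B, (y .: r). split; [easy|]. intros x; apply E.
Qed.

Lemma def2_def1_snd P v : def2 mem P -> def1 mem (fun x => P v x).
Proof.
  intros (B & r & HB & E).
  exists (rename (fun n => match n with 0 => 1 | 1 => 0 | S n => S n end) B), (v .: r).
  split; [now apply Delta0P_rename|]. intros x. rewrite E, eval_rename. f_equal.
  extensionality n; destruct n as [|[|n]]; reflexivity.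
Qed.

(** The environments are interleaved on even and odd indices, so that two formulas with separate
    parameters can be combined into one. *)
Lemma merge_env r s : exists (t : nat -> D) (f g : nat -> nat),
  r = (fun n => t (f n)) /\ s = (fun n => t (g n)).
Proof.
  exists (fun n => if Nat.even n then r (Nat.div2 n) else s (Nat.div2 n)).
  exists (fun n => 2 * n), (fun n => 2 * n + 1). split; extensionality n.
  - now rewrite Nat.even_even, Nat.div2_double.
  - now rewrite Nat.even_odd, Nat.add_1_r, Nat.div2_succ_double.
Qed.

Lemma def2_imp P Q : def2 mem P -> def2 mem Q -> def2 mem (fun x y => himp (P x y) (Q x y)).
Proof.
  intros (B & r & HB & EB) (C & s & HC & EC).
  destruct (merge_env r s) as (t & f & g & -> & ->).
  exists (FImp (rename (up (up f)) B) (rename (up (up g)) C)), t.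
  split; [split; now apply Delta0P_rename|]. intros x y. cbn [eval].
  rewrite EB, EC, !eval_rename. repeat f_equal; extensionality n;
    destruct n as [|[|n]]; reflexivity.
Qed.

End Definability.

(** * Relativization and subformulas *)

Lemma relz_Delta0 A : forall z, Delta0P A -> relz z A = A.
Proof. induction A; simpl; intros z H; f_equal; intuition. Qed.

Lemma Delta0P_relz A : forall z, Delta0P (relz z A).
Proof. induction A; simpl; auto. Qed.

Lemma rename_relz A : forall f z, rename f (relz z A) = relz (f z) (rename f A).
Proof. induction A; intros f z; simpl; f_equal; auto; apply (IHA (up f) (S z)). Qed.

Scheme SigmaP_mut := Minimality for SigmaP Sort Prop
  with PiP_mut := Minimality for PiP Sort Prop.
Combined Scheme SigmaP_PiP_ind from SigmaP_mut, PiP_mut.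

Fixpoint subformulas (A : form) : list form :=
  A :: match A with
       | FIn _ _ | FBot => []
       | FAnd B C | FOr B C | FImp B C => subformulas B ++ subformulas C
       | FAll B | FEx B | FBAll _ B | FBEx _ B | FSAll _ B | FSEx _ B => subformulas B
       end.

Section Forcing.
Context {b : beth} {D : Type} (mem : D -> D -> tv b).
Hypothesis valid : forall A, IKPP A -> forall r w, eval mem A r w.
Variables (U : form) (HU : Delta0P U).
Implicit Types (r : nat -> D) (w : world b).

Notation hsub := (hincl mem).
Notation ball := (hball mem). Notation bex := (hbex mem). Notation sall := (hsall mem).
Notation def0 := (def0 mem). Notation def1 := (def1 mem). Notation def2 := (def2 mem).
Notation hmono := (hmono mem).
Notation codes := (codes mem U).

(** * Conditions and their approximations *)

Definition approx p v := ball p (fun s => ball v (fun y => family mem U y s)).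
(** As [v] grows, [approx p v] becomes a stronger hypothesis, so for monotone [P] the stage [v] may
    be enlarged freely. *)
Definition eventually p (P : D -> tv b) := hex (fun v => himp (approx p v) (P v)).
(** The goals of the forcing model. When [k] codes a monotone [P], [target k] and [P] are
    interchangeable under [eventually]. *)
Definition target k v := bex v (fun z => family mem U z k).

Lemma approx_anti p q v u w : hsub p q w -> hsub v u w -> approx q u w -> approx p v w.
Proof.
  intros Hp Hv H s; hintro Hs. intros y; hintro Hy.
  exact (apply_imp (apply_imp (H s) (hsub_mem mem Hp Hs) y) (hsub_mem mem Hv Hy)).
Qed.

Lemma target_mono k : hmono (target k).
Proof.
  intros u v w H Hk. hdestruct Hk as z [Hz Hk].
  apply hex_intro with z; split; [exact (hsub_mem mem H Hz)|easy].
Qed.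

Lemma ev_family r y s :
  eval mem (rename (fun n => match n with 0 => y | _ => s end) U) r = family mem U (r y) (r s).
Proof.
  unfold family. rewrite eval_rename. f_equal. extensionality n; now destruct n.
Qed.

(** The formulas [Family], [Approx] and [Target] are the syntactic counterparts of [family],
    [approx] and [target]. *)
Definition Family y s := rename (fun n => match n with 0 => y | _ => s end) U.
Definition Approx p v := FBAll p (FBAll (S v) (Family 0 1)).
Definition Target k v := FBEx v (Family 0 (S k)).

Lemma Delta0P_Approx p v : Delta0P (Approx p v).
Proof. now apply Delta0P_rename. Qed.

Lemma Delta0P_Target k v : Delta0P (Target k v).
Proof. now apply Delta0P_rename. Qed.

Lemma ev_Approx p v r : eval mem (Approx p v) r = approx (r p) (r v).
Proof.
  unfold Approx, approx, Family; cbn [eval]. f_equal; extensionality s; f_equal; extensionality y.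
  apply ev_family.
Qed.

Lemma ev_Target k v r : eval mem (Target k v) r = target (r k) (r v).
Proof.
  unfold Target, target, Family; cbn [eval]. unfold hbex.
  f_equal; extensionality z. now rewrite ev_family.
Qed.

Lemma approx_def1 p : def1 (approx p).
Proof.
  exists (Approx 1 0), (fun _ => p). split; [apply Delta0P_Approx|].
  intros x; now rewrite ev_Approx.
Qed.

Lemma target_def1 k : def1 (target k).
Proof.
  exists (Target 1 0), (fun _ => k). split; [apply Delta0P_Target|].
  intros x; now rewrite ev_Target.
Qed.

Lemma family_def1 y : def1 (family mem U y).
Proof.
  exists (Family 1 0), (fun _ => y). split; [now apply Delta0P_rename|].
  intros x. unfold Family; now rewrite ev_family.
Qed.

Lemma const_mono X : hmono (fun _ => X).
Proof. now intros u v w _. Qed.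

Lemma eventually_map (P Q : D -> tv b) p q w : hsub p q w ->
  (forall v u, le w u -> P v u -> Q v u) ->
  eventually p P w -> eventually q Q w.
Proof.
  intros Hp H HP. apply (hex_elim _ _ HP). intros v u L Hv. apply hex_intro with v.
  intros u' L' Hq. apply H; [eapply le_trans; eauto|]. apply (Hv u' L').
  eapply approx_anti; [|apply hsub_refl|exact Hq].
  eapply holds_mono; [|exact Hp]. eapply le_trans; eauto.
Qed.

Lemma eventually_cond P p q w : hsub p q w -> eventually p P w -> eventually q P w.
Proof. intros H; apply eventually_map; auto. Qed.

Lemma eventually_const (X : tv b) p w : X w -> eventually p (fun _ => X) w.
Proof.
  intros H. apply hex_intro with p. now hintro H'.
Qed.

Lemma eventually_and P Q p w : hmono P -> hmono Q -> eventually p P w -> eventually p Q w ->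
  eventually p (fun v => hand (P v) (Q v)) w.
Proof.
  intros HP HQ H1 H2. hdestruct H1 as v1 H1. hdestruct H2 as v2 H2.
  hdestruct (union2 mem valid v1 v2 w1) as v [L1 L2]. apply hex_intro with v.
  hintro H. split; [apply (HP v1 v); [easy|]|apply (HQ v2 v); [easy|]];
    [apply (apply_imp H1)|apply (apply_imp H2)];
    (eapply approx_anti; [apply hsub_refl| |exact H]; assumption).
Qed.

Lemma eventually_def2 P p : def2 P -> def2 (fun v x => himp (approx p v) (P v x)).
Proof. apply def2_imp, def1_def2_fst, approx_def1. Qed.

Lemma eventually_mono P p : hmono P -> hmono (fun v => himp (approx p v) (P v)).
Proof.
  intros HP u v w L H. hintro Ha. apply (HP u v); [easy|]. apply (apply_imp H).
  eapply approx_anti; [apply hsub_refl|exact L|exact Ha].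
Qed.

(** The ranges over which collection is available. Elements of a set and subsets of a set are the
    two instances, so both sorts of bounded quantifier are treated at once. *)
Definition bounded (m : D -> tv b) := forall P w, def2 P ->
  (forall x, hmono (fun v => P v x)) ->
  hall (fun x => himp (m x) (hex (fun v => P v x))) w ->
  hex (fun v => hall (fun x => himp (m x) (P v x))) w.

Lemma bounded_mem a : bounded (fun x => mem x a).
Proof. intros P w. apply collection_mono, valid. Qed.

Lemma bounded_sub a : bounded (fun x => hsub x a).
Proof. intros P w. apply collection_sub, valid. Qed.

Lemma eventually_hall m P p w : bounded m -> def2 P -> (forall x, hmono (fun v => P v x)) ->
  hall (fun x => himp (m x) (eventually p (fun v => P v x))) w ->
  eventually p (fun v => hall (fun x => himp (m x) (P v x))) w.
Proof.
  intros Hm Hd HP H.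
  pose proof (Hm _ w (eventually_def2 P p Hd) (fun x => eventually_mono _ p (HP x)) H) as Q.
  hdestruct Q as v Hv. apply hex_intro with v. hintro Ha. intros x; hintro Hx.
  exact (apply_imp (apply_imp (Hv x) Hx) Ha).
Qed.

Lemma eventually_imp X P p w : def0 X -> def1 P -> hmono P ->
  himp X (eventually p P) w -> eventually p (fun v => himp X (P v)) w.
Proof.
  intros HX Hd HP H.
  assert (Hd' : def1 (fun v => himp (approx p v) (P v))).
  { apply def2_def1; [|exact p]. apply (eventually_def2 (fun v _ => P v)), def1_def2_fst, Hd. }
  pose proof (collection_imp mem valid X _ (fun _ => p) w HX Hd' (eventually_mono _ p HP) H) as Q.
  hdestruct Q as v Hv. apply hex_intro with v. hintro Ha. hintro Hx.
  exact (apply_imp (apply_imp Hv Hx) Ha).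
Qed.

(** Collection moves [eventually] out of the implication, after which the stages for [X] and for the
    implication are joined. *)
Lemma eventually_bind X P p w : def0 X -> def1 P -> hmono P ->
  eventually p (fun _ => X) w -> himp X (eventually p P) w -> eventually p P w.
Proof.
  intros HX Hd HP H1 H2. pose proof (eventually_imp X P p w HX Hd HP H2) as H3.
  assert (Hm : hmono (fun v => himp X (P v))).
  { intros u v w' L Q. hintro Hx. apply (HP u v); [easy|]. exact (apply_imp Q Hx). }
  pose proof (eventually_and _ _ p w (const_mono X) Hm H1 H3) as H4. revert H4.
  apply eventually_map; [apply hsub_refl|]. intros v u _ [Q1 Q2]. exact (apply_imp Q2 Q1).
Qed.

(** An element [z] of [u] satisfying [P] is a subset of the union of [u], so monotonicity gives [P]
    at every superset of that union. *)
Lemma eventually_target k P p w : hmono P ->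
  codes k P w -> eventually p (target k) w -> eventually p P w.
Proof.
  intros HP Hk H. hdestruct H as u Hu. hdestruct (superset_union mem valid u w0) as v [H1 H2].
  apply hex_intro with v. hintro Ha.
  assert (Ha' : approx p u w2).
  { eapply approx_anti; [apply hsub_refl|exact H1|exact Ha]. }
  hdestruct (apply_imp Hu Ha') as z [Hz Hf]. apply (HP z v).
  - exact (apply_imp (H2 z) Hz).
  - exact (apply_imp (proj1 (Hk z)) Hf).
Qed.

(** The stage [u] at which [P] holds is itself adjoined as the element witnessing the target. *)
Lemma target_eventually k P p w : codes k P w -> eventually p P w -> eventually p (target k) w.
Proof.
  intros Hk H. hdestruct H as u Hu. hdestruct (superset_adjoin mem valid u u w0) as v [H1 H2].
  apply hex_intro with v. hintro Ha. apply hex_intro with u. split; [easy|].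
  apply (apply_imp (proj2 (Hk u))), (apply_imp Hu).
  eapply approx_anti; [apply hsub_refl|exact H1|exact Ha].
Qed.

(** * The forcing model *)

Program Definition forcing_beth : beth := {|
  world := world b * D;
  le := fun wp vq => le (fst wp) (fst vq) /\ hsub (snd wp) (snd vq) (fst vq);
  goal := D;
  meets := fun k wp => eventually (snd wp) (target k) (fst wp) |}.
Next Obligation. intros [w p]; split; [apply le_refl|apply hsub_refl]. Qed.
Next Obligation.
  intros [u p] [v q] [w s] [L1 H1] [L2 H2]; cbn in *. split; [eapply le_trans; eauto|].
  eapply hsub_trans; [|exact H2]. eapply holds_mono; eauto.
Qed.
Next Obligation.
  intros k [w p] [v q] [L H] H'; cbn in *. apply (eventually_cond _ p); [easy|].
  eapply holds_mono; eauto.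
Qed.

Notation ftv := (tv forcing_beth).

(** Fixing the condition turns a forcing truth value into one of the ground model, so that ground
    disjunctions and existentials can be eliminated into forcing statements. *)
Program Definition slice (X : ftv) p : tv b := Tv b (fun w => X (w, p)) _ _.
Next Obligation.
  intros X p v w L H. eapply (holds_mono X); [|exact H]. split; [exact L|apply hsub_refl].
Qed.
Next Obligation.
  intros X p w H. apply holds_jcl. intros k [u q] [L Hp] HX; cbn in *.
  (* Meeting the goal [k] is itself a ground truth value, hence closed under the ground nucleus. *)
  apply holds_jcl. intros g v L' Hg. apply (H g v); [eapply le_trans; eauto|].
  intros t Lt HX'. apply Hg; [easy|].
  assert (Lu : le u t) by (eapply le_trans; eauto).
  apply (HX (t, q)).
  - split; [exact Lu|apply hsub_refl].
  - eapply (holds_mono X); [|exact HX']. split; cbn; [apply le_refl|].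
    eapply holds_mono; eauto.
Qed.

Definition forced P : ftv := hjcl (fun wp : world forcing_beth => eventually (snd wp) P (fst wp)).
Definition fmem x y : ftv := forced (fun _ => mem x y).

Lemma slice_cond X p q w : hsub p q w -> slice X p w -> slice X q w.
Proof.
  intros H HX. eapply (holds_mono X); [|exact HX]. split; [apply le_refl|exact H].
Qed.

Lemma slice_imp X Y p w : slice (himp X Y) p w <->
  forall q v, le w v -> hsub p q v -> slice X q v -> slice Y q v.
Proof.
  split.
  - intros H q v L Hp HX. apply (H (v, q)); [now split|exact HX].
  - intros H [v q] [L Hp] HX. now apply H.
Qed.

Definition represented P := forall w, hex (fun k => codes k P) w.

(** With a code [k] of [P], [eventually q P] amounts to meeting the goal [k], which the nucleus
    fixes. *)
Lemma jcl_eventually_elim S P p w : represented P -> hmono P ->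
  @jcl forcing_beth S (w, p) ->
  (forall v q, le w v -> hsub p q v -> S (v, q) -> eventually q P v) -> eventually p P w.
Proof.
  intros HP Hm HS H. apply (hex_elim _ _ (HP w)). intros k v L Hk.
  apply eventually_target with k; [easy..|].
  apply (HS k (v, p)); [split; [exact L|apply hsub_refl]|].
  intros [u q] [L' Hq] Hu; cbn in *. apply target_eventually with P.
  - eapply holds_mono; eauto.
  - apply H; [eapply le_trans; eauto| |exact Hu]; easy.
Qed.

(** * Forcing clauses for monotone families *)

Definition forces X P := forall p w, slice X p w <-> eventually p P w.

Lemma forces_forced P : represented P -> hmono P -> forces (forced P) P.
Proof.
  intros HP Hm p w. split; intros H.
  - apply (jcl_eventually_elim _ _ p w HP Hm H). intros v q _ _ K; exact K.
  - apply jcl_intro. intros [v q] [L Hp]; cbn in *. apply (eventually_cond _ p); [easy|].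
    eapply holds_mono; eauto.
Qed.

(** By [eventually_bind] a goal may be met under a bounded assumption that holds eventually; the
    closure of [Y] extends this from goals to [Y]. *)
Lemma cover X Y p w : def0 X -> eventually p (fun _ => X) w -> himp X (slice Y p) w -> slice Y p w.
Proof.
  intros HX H1 H2. apply (holds_jcl Y (w, p)). intros k [v q] [L Hp] HY; cbn in *. up_along L.
  apply (eventually_bind X); [easy|apply target_def1|apply target_mono| |].
  - now apply (eventually_cond _ p).
  - hintro Hx. apply (HY (w0, q)); [split; [easy|apply hsub_refl]|].
    apply (slice_cond _ p); [easy|]. exact (apply_imp H2 Hx).
Qed.

Lemma cover_eventually P Y p w : (forall v, def0 (P v)) -> eventually p P w ->
  (forall v, himp (P v) (slice Y p) w) -> slice Y p w.
Proof.
  intros HP H HY. apply (hex_elim _ _ H). intros v u L Hv. apply (cover (P v)); [easy| |].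
  - apply hex_intro with v. exact Hv.
  - eapply holds_mono; [exact L|apply HY].
Qed.

Lemma forces_const X P x w p : forces X P -> P x w -> slice X p w.
Proof.
  intros H HP. apply H. apply hex_intro with x. now hintro H'.
Qed.

Lemma forces_and X Y P Q : hmono P -> hmono Q -> forces X P -> forces Y Q ->
  forces (hand X Y) (fun v => hand (P v) (Q v)).
Proof.
  intros MP MQ HX HY p w. split.
  - intros [H1 H2]. apply eventually_and; [easy..|now apply HX|now apply HY].
  - intros H; split; [apply HX|apply HY]; revert H; apply eventually_map;
      try apply hsub_refl; intros v u _ [Q1 Q2]; easy.
Qed.

Lemma forces_or X Y P Q : represented (fun v => hor (P v) (Q v)) ->
  hmono (fun v => hor (P v) (Q v)) -> (forall v, def0 (hor (P v) (Q v))) ->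
  forces X P -> forces Y Q -> forces (hor X Y) (fun v => hor (P v) (Q v)).
Proof.
  intros R M Hd HX HY p w. split; intros H.
  - apply (jcl_eventually_elim _ _ p w R M H). intros v q _ _ [Q1|Q1].
    + apply HX in Q1. revert Q1. apply eventually_map; [apply hsub_refl|].
      intros; now apply hor_intro1.
    + apply HY in Q1. revert Q1. apply eventually_map; [apply hsub_refl|].
      intros; now apply hor_intro2.
  - apply (cover_eventually _ _ p w Hd H). intros v. hintro Hv. hcases Hv as K.
    + apply (hor_intro1 X Y). now apply forces_const with P v.
    + apply (hor_intro2 X Y). now apply forces_const with Q v.
Qed.

Lemma hmono_hall m P : (forall x, hmono (fun v => P v x)) ->
  hmono (fun v => hall (fun x : D => himp (m x) (P v x))).
Proof.
  intros HP u v w L H x. hintro Hx. apply (HP x u v); [easy|]. exact (apply_imp (H x) Hx).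
Qed.

Lemma hmono_hex m P : (forall x, hmono (fun v => P v x)) ->
  hmono (fun v => hex (fun x : D => hand (m x) (P v x))).
Proof.
  intros HP u v w L H. hdestruct H as x [Hx H]. apply hex_intro with x.
  split; [easy|]. now apply (HP x u v).
Qed.

Lemma forces_hall m (M X : D -> ftv) P : bounded m -> def2 P ->
  (forall x, hmono (fun v => P v x)) ->
  (forall x, forces (M x) (fun _ => m x)) -> (forall x, forces (X x) (fun v => P v x)) ->
  forces (hall (fun x => himp (M x) (X x))) (fun v => hall (fun x => himp (m x) (P v x))).
Proof.
  intros B Hd Hm HM HX p w. split; intros H.
  - apply eventually_hall; [easy..|]. intros x u L Hx. apply HX.
    apply (H x (u, p)); [split; [easy|apply hsub_refl]|].
    now apply (forces_const (M x) (fun _ => m x) x).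
  - intros x [u q] [L Hq] Hx; cbn in *. apply HX. apply HM in Hx. up_along L.
    apply (eventually_cond _ _ q) in H; [|easy].
    pose proof (eventually_and _ _ q u (const_mono (m x)) (hmono_hall m P Hm) Hx H) as Q.
    revert Q. apply eventually_map; [apply hsub_refl|]. intros v t _ [Q1 Q2].
    exact (apply_imp (Q2 x) Q1).
Qed.

Lemma forces_hex m (M X : D -> ftv) P :
  represented (fun v => hex (fun x => hand (m x) (P v x))) ->
  (forall v, def0 (hex (fun x => hand (m x) (P v x)))) ->
  (forall x, hmono (fun v => P v x)) ->
  (forall x, forces (M x) (fun _ => m x)) -> (forall x, forces (X x) (fun v => P v x)) ->
  forces (hex (fun x => hand (M x) (X x))) (fun v => hex (fun x => hand (m x) (P v x))).
Proof.
  intros R Hd Hm HM HX p w. split; intros H.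
  - apply (jcl_eventually_elim _ _ p w R (hmono_hex m P Hm) H). intros v q _ _ [x [H1 H2]].
    apply HM in H1. apply HX in H2.
    pose proof (eventually_and _ _ q v (const_mono (m x)) (Hm x) H1 H2) as Q. revert Q.
    apply eventually_map; [apply hsub_refl|]. intros u t _ Q. now apply hex_intro with x.
  - apply (cover_eventually _ _ p w Hd H). intros v. hintro Hv. hdestruct Hv as x [H1 H2].
    apply (hex_intro (fun x => hand (M x) (X x)) x). split.
    + now apply (forces_const (M x) (fun _ => m x) x).
    + now apply (forces_const (X x) (fun v => P v x) v).
Qed.

Lemma forces_unbounded_hex (X : D -> ftv) P :
  represented (fun v => bex v (P v)) -> (forall v, def0 (bex v (P v))) ->
  (forall x, hmono (fun v => P v x)) -> (forall x, forces (X x) (fun v => P v x)) ->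
  forces (hex X) (fun v => bex v (P v)).
Proof.
  intros R Hd Hm HX p w.
  assert (M : hmono (fun v => bex v (P v))).
  { intros u v t L Q. hdestruct Q as x [Q1 Q2]. apply hex_intro with x.
    split; [exact (hsub_mem mem L Q1)|]. now apply (Hm x u v). }
  split; intros H.
  - apply (jcl_eventually_elim _ _ p w R M H). intros v q _ _ [x H1].
    apply HX in H1. hdestruct H1 as u Hu.
    (* The witness [x] is adjoined to the stage, so that the quantifier bounded by the stage reaches
       it. *)
    hdestruct (superset_adjoin mem valid u x w0) as u' [L1 L2].
    apply hex_intro with u'. hintro Ha. apply hex_intro with x. split; [easy|].
    apply (Hm x u u'); [easy|]. apply (apply_imp Hu).
    eapply approx_anti; [apply hsub_refl|exact L1|exact Ha].
  - apply (cover_eventually _ _ p w Hd H). intros v. hintro Hv. hdestruct Hv as x [H1 H2].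
    apply (hex_intro X x). now apply (forces_const (X x) (fun v => P v x) v).
Qed.

(** * Forcing clauses for antitone families *)

Definition hanti (P : D -> tv b) := forall u v w, hsub u v w -> P v w -> P u w.

(* Used for Pi^P-formulas, whose restrictions to [v] are antitone in [v]. *)
Definition forces_all X (P : D -> tv b) :=
  forall p w, slice X p w <-> hall (fun v => eventually p (fun _ => P v)) w.

(** The condition [q] adds to [p] the assumption that [P] holds throughout; it is described by its
    effect on approximations. *)
Definition extends p (P : D -> tv b) q := hand (hsub p q)
  (hall (fun v => hiff (approx q v) (hand (approx p v) (ball v P)))).

(** The new condition is [p] with a code of [P] adjoined. *)
Lemma add_condition P p w : represented P -> hex (extends p P) w.
Proof.
  intros R. hdestruct (R w) as s Hs. hdestruct (adjoin mem valid p s w0) as q Hq.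
  apply hex_intro with q. split; [|intros v; split; hintro H; [split|]].
  - intros x; hintro Hx. apply (apply_imp (proj2 (Hq x))). now apply hor_intro1.
  - intros x; hintro Hx. apply (apply_imp (H x)).
    apply (apply_imp (proj2 (Hq x))). now apply hor_intro1.
  - intros y; hintro Hy. apply (apply_imp (proj1 (Hs y))).
    refine (apply_imp (apply_imp (H s) _ y) Hy).
    apply (apply_imp (proj2 (Hq s))). apply hor_intro2, heq_refl.
  - destruct H as [H1 H2]. intros x; hintro Hx. intros y; hintro Hy.
    hcases (apply_imp (proj1 (Hq x)) Hx) as Q.
    + exact (apply_imp (apply_imp (H1 x) Q y) Hy).
    + apply (extensionality_def1 mem valid _ s x _ (family_def1 y)); [now apply heq_sym|].
      apply (apply_imp (proj2 (Hs y))). exact (apply_imp (H2 y) Hy).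
Qed.

(** For given [v], any stage having [v] as an element suffices. *)
Lemma extends_forces P X p q w : forces_all X P -> extends p P q w -> slice X q w.
Proof.
  intros HX [_ H]. apply HX. intros v.
  hdestruct (pairing mem valid v v w) as u [Hu _]. apply hex_intro with u.
  hintro Ha. exact (apply_imp (proj2 (apply_imp (proj1 (H u)) Ha) v) Hu).
Qed.

(** A deduction principle for conditions. The stage [u] is enlarged by its union, so its elements
    become subsets of the new stage [v], and antitonicity takes [P v] down to each of them. *)
Lemma extends_eventually (P Q : D -> tv b) p q w : hanti P -> hmono Q ->
  extends p P q w -> eventually q Q w ->
  eventually p (fun v => himp (P v) (Q v)) w.
Proof.
  intros HP HQ [_ H] K. hdestruct K as u Hu.
  hdestruct (superset_union mem valid u w0) as v [L1 L2]. apply hex_intro with v.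
  hintro Ha. hintro Hp. apply (HQ u v); [easy|]. apply (apply_imp Hu).
  apply (apply_imp (proj2 (H u))). split.
  - eapply approx_anti; [apply hsub_refl|exact L1|exact Ha].
  - intros y; hintro Hy. apply (HP y v); [|easy]. exact (apply_imp (L2 y) Hy).
Qed.

(** From left to right the premise is added to the condition, and the conclusion then forced is
    brought back by [extends_eventually]. From right to left the premise is used only at the stage
    [v] of the given implication. *)
Lemma forces_imp X Y P Q : represented P -> hanti P -> hmono Q ->
  forces_all X P -> forces Y Q -> forces (himp X Y) (fun v => himp (P v) (Q v)).
Proof.
  intros R HP HQ HX HY p w. rewrite slice_imp. split.
  - intros H. hdestruct (add_condition P p w R) as q Hq.
    apply (extends_eventually P Q p q); [easy..|]. apply HY, H; [easy|apply Hq|].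
    now apply (extends_forces P X p q).
  - intros H q u L Hq Hx. apply HY. up_along L. apply (eventually_cond _ _ q) in H; [|easy].
    hdestruct H as v Hv. pose proof (proj1 (HX q w0) Hx v) as Hx'.
    hdestruct Hx' as v' Hv'.
    hdestruct (union2 mem valid v v' w1) as t [L1 L2]. apply hex_intro with t.
    hintro Ha. apply (HQ v t); [easy|].
    assert (A1 : approx q v w3) by (eapply approx_anti; [apply hsub_refl|exact L1|exact Ha]).
    assert (A2 : approx q v' w3) by (eapply approx_anti; [apply hsub_refl|exact L2|exact Ha]).
    exact (apply_imp (apply_imp Hv A1) (apply_imp Hv' A2)).
Qed.

Lemma forces_all_const X P : forces X (fun _ => P) -> forces_all X (fun _ => P).
Proof.
  intros H p w. rewrite (H p w). split; [now intros H' v|]. intros H'; exact (H' p).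
Qed.

Lemma forces_all_and X Y P Q : forces_all X P -> forces_all Y Q ->
  forces_all (hand X Y) (fun v => hand (P v) (Q v)).
Proof.
  intros HX HY p w. split.
  - intros [H1 H2] v. apply HX in H1. apply HY in H2.
    apply eventually_and; [apply const_mono..|exact (H1 v)|exact (H2 v)].
  - intros H. split; [apply HX|apply HY]; intros v; generalize (H v); apply eventually_map;
      try apply hsub_refl; now intros u t _ [H1 H2].
Qed.

Lemma jcl_eventually_const S X p w : represented (fun _ => X) ->
  @jcl forcing_beth S (w, p) ->
  (forall v q, le w v -> hsub p q v -> S (v, q) -> eventually q (fun _ => X) v) ->
  eventually p (fun _ => X) w.
Proof. intros R. apply jcl_eventually_elim; [easy|apply const_mono]. Qed.

(** For the second direction, a goal is met under each disjunct by adding that disjunct to the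
    condition. The two stages obtained have a common superset [v], and the disjunction is used at
    this single [v] only. *)
Lemma forces_all_or X Y P Q : represented P -> represented Q -> hanti P -> hanti Q ->
  (forall v, represented (fun _ => hor (P v) (Q v))) ->
  (forall v, def0 (hor (P v) (Q v))) ->
  forces_all X P -> forces_all Y Q -> forces_all (hor X Y) (fun v => hor (P v) (Q v)).
Proof.
  intros RP RQ AP AQ R Hd HX HY p w. split.
  - intros H v. apply (jcl_eventually_const _ _ p w (R v) H). intros u q _ _ [K|K].
    + apply HX in K. generalize (K v). apply eventually_map; [apply hsub_refl|].
      intros; now apply hor_intro1.
    + apply HY in K. generalize (K v). apply eventually_map; [apply hsub_refl|].
      intros; now apply hor_intro2.
  - intros H k [u q] [L Hq] Hk; cbn in *. up_along L.
    hdestruct (add_condition P q u RP) as q1 H1.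
    hdestruct (add_condition Q q w0 RQ) as q2 H2.
    assert (K1 : eventually q1 (target k) w1).
    { apply (Hk (w1, q1)); [split; [eapply le_trans; eauto|apply H1]|].
      left. now apply (extends_forces P X q q1). }
    assert (K2 : eventually q2 (target k) w1).
    { apply (Hk (w1, q2)); [split; [eapply le_trans; eauto|apply H2]|].
      right. now apply (extends_forces Q Y q q2). }
    apply (extends_eventually P _ q q1) in K1; [|easy|apply target_mono|easy].
    apply (extends_eventually Q _ q q2) in K2; [|easy|apply target_mono|easy].
    hdestruct K1 as v1 K1. hdestruct K2 as v2 K2.
    hdestruct (union2 mem valid v1 v2 w3) as v [L1' L2'].
    apply (eventually_bind (hor (P v) (Q v)));
      [easy|apply target_def1|apply target_mono|now apply (eventually_cond _ p), H|].
    hintro K. apply hex_intro with v. hintro Ha. hcases K as K'.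
    + apply (target_mono k v1 v); [easy|].
      apply (fun A => apply_imp (apply_imp K1 A) (AP v1 v _ L1' K')).
      eapply approx_anti; [apply hsub_refl|exact L1'|exact Ha].
    + apply (target_mono k v2 v); [easy|].
      apply (fun A => apply_imp (apply_imp K2 A) (AQ v2 v _ L2' K')).
      eapply approx_anti; [apply hsub_refl|exact L2'|exact Ha].
Qed.

Lemma forces_all_hall m (M X : D -> ftv) P : bounded m -> def2 P ->
  (forall x, forces (M x) (fun _ => m x)) -> (forall x, forces_all (X x) (fun v => P v x)) ->
  forces_all (hall (fun x => himp (M x) (X x))) (fun v => hall (fun x => himp (m x) (P v x))).
Proof.
  intros B Hd HM HX p w. split; intros H.
  - intros v. apply (eventually_hall m (fun _ x => P v x)); [easy| |intros; apply const_mono|].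
    { apply (def1_def2_snd mem), (def2_def1_snd mem), Hd. }
    intros x u L Hx. apply (HX x p u).
    apply (H x (u, p)); [split; [easy|apply hsub_refl]|].
    now apply (forces_const (M x) (fun _ => m x) x).
  - intros x [u q] [L Hq] Hx; cbn in *. apply HX. apply HM in Hx. up_along L. intros v.
    pose proof (eventually_cond _ _ q _ Hq (H v)) as K.
    pose proof (eventually_and _ _ q u (const_mono (m x)) (const_mono _) Hx K) as Q.
    revert Q. apply eventually_map; [apply hsub_refl|]. intros t t' _ [Q1 Q2].
    exact (apply_imp (Q2 x) Q1).
Qed.

(** The argument for disjunction applies, with collection over the bounded range giving one stage
    for all [x]. *)
Lemma forces_all_hex m (M X : D -> ftv) P : bounded m -> def2 P ->
  (forall v, represented (fun _ => hex (fun x => hand (m x) (P v x)))) ->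
  (forall v, def0 (hex (fun x => hand (m x) (P v x)))) ->
  (forall x, represented (fun v => P v x)) -> (forall x, hanti (fun v => P v x)) ->
  (forall x, forces (M x) (fun _ => m x)) -> (forall x, forces_all (X x) (fun v => P v x)) ->
  forces_all (hex (fun x => hand (M x) (X x))) (fun v => hex (fun x => hand (m x) (P v x))).
Proof.
  intros B Hd R Hd0 RP AP HM HX p w. split; intros H.
  - intros v. apply (jcl_eventually_const _ _ p w (R v) H). intros u q _ _ [x [K1 K2]].
    apply HM in K1. apply HX in K2.
    pose proof (eventually_and _ _ q u (const_mono (m x)) (const_mono _) K1 (K2 v)) as Q. revert Q.
    apply eventually_map; [apply hsub_refl|]. intros t t' _ Q. now apply hex_intro with x.
  - intros k [u q] [L Hq] Hk; cbn in *. up_along L.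
    assert (K : hall (fun x => himp (m x) (eventually q (fun v => himp (P v x) (target k v)))) u).
    { intros x. hintro Hx. hdestruct (add_condition _ q w0 (RP x)) as q' Hq'.
      apply (extends_eventually (fun v => P v x) (target k) q q');
        [easy|apply target_mono|easy|].
      apply (Hk (w1, q')); [split; [eapply le_trans; eauto|apply Hq']|]. exists x. split.
      - now apply (forces_const (M x) (fun _ => m x) x).
      - now apply (extends_forces (fun v => P v x) (X x) q q'). }
    apply (eventually_hall m (fun v x => himp (P v x) (target k v))) in K; [|easy| |].
    2:{ apply def2_imp; [easy|]. apply def1_def2_fst, target_def1. }
    2:{ intros x v v' t Lv Q. hintro Hp. apply (target_mono k v v'); [easy|].
        apply (apply_imp Q). now apply (AP x v v'). }
    hdestruct K as v Hv.
    apply (eventually_bind (hex (fun x => hand (m x) (P v x))));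
      [easy|apply target_def1|apply target_mono|now apply (eventually_cond _ p), H|].
    hintro K. apply hex_intro with v. hintro Ha. hdestruct K as x [K1 K2].
    exact (apply_imp (apply_imp (apply_imp Hv Ha x) K1) K2).
Qed.

Lemma forces_all_unbounded_hall (X : D -> ftv) P : def2 P ->
  (forall x, hanti (fun v => P v x)) -> (forall x, forces_all (X x) (fun v => P v x)) ->
  forces_all (hall X) (fun v => ball v (P v)).
Proof.
  intros Hd A HX p w. split; intros H.
  - intros v. apply (eventually_hall (fun x => mem x v) (fun _ x => P v x));
      [apply bounded_mem|apply (def1_def2_snd mem), (def2_def1_snd mem), Hd
      |intros; apply const_mono|].
    intros x. hintro Hx. exact (proj1 (HX x p w0) (H x) v).
  - intros x. apply HX. intros v.
    (* The hypothesis is used at a stage containing [x], and antitonicity returns to [v]. *)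
    hdestruct (superset_adjoin mem valid v x w) as v' [L1 L2].
    generalize (H v'). apply eventually_map; [apply hsub_refl|]. intros t t' L' Q. up_along L'.
    apply (A x v v'); [easy|]. exact (apply_imp (Q x) L2).
Qed.

(** For the second direction, the premise holds eventually at some [v1]. The hypothesis is used at a
    superset of [v] and [v1], to which [P] ascends by monotonicity and from which [Q] descends to
    [v] by antitonicity. *)
Lemma forces_all_imp X Y P Q : (forall v, def0 (P v)) -> (forall v, def0 (Q v)) ->
  hmono P -> hanti Q -> forces X P -> forces_all Y Q ->
  forces_all (himp X Y) (fun v => himp (P v) (Q v)).
Proof.
  intros HP HQ MP AQ HX HY p w. rewrite slice_imp. split.
  - intros H v. apply eventually_imp; [easy|apply def0_def1, HQ|apply const_mono|].
    hintro K. apply (HY p w0). apply H; [easy|apply hsub_refl|].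
    now apply (forces_const X P v).
  - intros H q u L Hq Hx. apply HY. apply HX in Hx. up_along L. intros v.
    hdestruct Hx as v1 H1. hdestruct (union2 mem valid v v1 w0) as v2 [L1 L2].
    pose proof (eventually_cond _ _ q _ Hq (H v2)) as K.
    hdestruct K as v3 H3. hdestruct (union2 mem valid v1 v3 w2) as t [L3 L4].
    apply hex_intro with t. hintro Ha. apply (AQ v v2); [easy|].
    assert (A1 : approx q v1 w4) by (eapply approx_anti; [apply hsub_refl|exact L3|exact Ha]).
    assert (A3 : approx q v3 w4) by (eapply approx_anti; [apply hsub_refl|exact L4|exact Ha]).
    apply (apply_imp (apply_imp H3 A3)). apply (MP v1 v2); [easy|]. exact (apply_imp H1 A1).
Qed.

(** * Forcing of bounded formulas *)

Notation fev := (eval fmem).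

Hypothesis truth : universal_for mem U (FBEx 1 (FImp FBot FBot)).

(** Every bounded truth value is the inhabitedness of a set, and inhabitedness of a parameter is
    among the families coded by [U]. *)
Lemma represented_const X : def0 X -> represented (fun _ => X).
Proof.
  intros HX w. pose proof HX as (_ & r & _).
  hdestruct (truth_value mem valid X r w HX) as t Ht.
  hdestruct (truth (t .: r) w0) as k Hk. apply hex_intro with k.
  revert Hk. apply codes_iff. intros y v L. eapply holds_mono; eauto.
Qed.

Lemma const_anti X : hanti (fun _ => X).
Proof. now intros u v w _. Qed.

Lemma forces_mem x y : forces (fmem x y) (fun _ => mem x y).
Proof.
  apply forces_forced; [|apply const_mono]. apply represented_const.
  now exists (FIn 0 1), (x .: fun _ => y).
Qed.

Lemma forces_sub x y : forces (hincl fmem x y) (fun _ => hsub x y).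
Proof.
  apply (forces_hall (fun z => mem z x) (fun z => fmem z x) (fun z => fmem z y)
          (fun _ z => mem z y)).
  - apply bounded_mem.
  - exists (FIn 1 2), (fun _ => y). now split.
  - intros; apply const_mono.
  - intros; apply forces_mem.
  - intros; apply forces_mem.
Qed.

Lemma ev_def1 A r : Delta0P A -> def1 (fun x => eval mem A (x .: r)).
Proof. now exists A, r. Qed.

(** Constant families are both monotone and antitone, so the clauses above apply with no dependence
    on the stage; even here an implication is handled by adding its premise to the condition. *)
Theorem forces_Delta0 A : Delta0P A -> forall r, forces (fev A r) (fun _ => eval mem A r).
Proof.
  induction A; intros HA r; simpl in HA; try (now destruct HA).
  - apply forces_mem.
  - intros p w; split; intros H.
    + apply (jcl_eventually_const _ _ p w (represented_const _ (def0_ev mem FBot r I)) H).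
      now intros v q _ _ K.
    + apply (cover hbot hbot); [now exists FBot, r|exact H|].
      hintro K. now apply hbot_elim.
  - destruct HA as [H1 H2].
    apply (forces_and _ _ (fun _ => _) (fun _ => _)); try apply const_mono; auto.
  - destruct HA as [H1 H2].
    apply (forces_or _ _ (fun _ => _) (fun _ => _)); try apply const_mono; auto.
    + apply represented_const. now apply (def0_ev mem (FOr A1 A2)).
    + intros _. now apply (def0_ev mem (FOr A1 A2)).
  - destruct HA as [H1 H2]. apply (forces_imp _ _ (fun _ => _) (fun _ => _)).
    + now apply represented_const, def0_ev.
    + apply const_anti.
    + apply const_mono.
    + now apply forces_all_const, IHA1.
    + now apply IHA2.
  - apply (forces_hall (fun x => mem x (r n)) (fun x => fmem x (r n))
      (fun x => fev A (x .: r)) (fun _ x => eval mem A (x .: r))).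
    + apply bounded_mem.
    + now apply def1_def2_snd, ev_def1.
    + intros; apply const_mono.
    + intros; apply forces_mem.
    + intros; now apply IHA.
  - apply (forces_hex (fun x => mem x (r n)) (fun x => fmem x (r n))
      (fun x => fev A (x .: r)) (fun _ x => eval mem A (x .: r))).
    + apply represented_const. now apply (def0_ev mem (FBEx n A)).
    + intros _. now apply (def0_ev mem (FBEx n A)).
    + intros; apply const_mono.
    + intros; apply forces_mem.
    + intros; now apply IHA.
  - apply (forces_hall (fun x => hsub x (r n)) (fun x => hincl fmem x (r n))
      (fun x => fev A (x .: r)) (fun _ x => eval mem A (x .: r))).
    + apply bounded_sub.
    + now apply def1_def2_snd, ev_def1.
    + intros; apply const_mono.
    + intros; apply forces_sub.
    + intros; now apply IHA.
  - apply (forces_hex (fun x => hsub x (r n)) (fun x => hincl fmem x (r n))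
      (fun x => fev A (x .: r)) (fun _ x => eval mem A (x .: r))).
    + apply represented_const. now apply (def0_ev mem (FSEx n A)).
    + intros _. now apply (def0_ev mem (FSEx n A)).
    + intros; apply const_mono.
    + intros; apply forces_sub.
    + intros; now apply IHA.
Qed.

(** * Relativized formulas as families indexed by the stage *)

Definition rel A r v := eval mem (relz 0 (shift A)) (v .: r).

Lemma rel_Delta0 A r : Delta0P A -> rel A r = fun _ => eval mem A r.
Proof.
  intros HA; extensionality v; unfold rel. rewrite relz_Delta0.
  - apply eval_shift.
  - now apply Delta0P_rename.
Qed.

(** The two sides differ by the order of the stage and the bound variable, which [f] exchanges. *)
Lemma rel_under A r v x :
  eval mem (relz 1 (rename (up S) A)) (x .: v .: r) = rel A (x .: r) v.
Proof.
  set (f := fun n => match n with 0 => 1 | 1 => 0 | S (S n) => S (S n) end).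
  replace (relz 1 (rename (up S) A)) with (rename f (relz 0 (shift A))).
  - rewrite eval_rename. unfold rel. f_equal. extensionality n; destruct n as [|[|n]]; reflexivity.
  - rewrite rename_relz. unfold shift. rewrite rename_comp. reflexivity.
Qed.

Lemma rel_all A r : rel (FAll A) r = fun v => ball v (fun x => rel A (x .: r) v).
Proof.
  extensionality v. exact (f_equal (ball v)
    (functional_extensionality _ _ (rel_under A r v))).
Qed.
Lemma rel_ex A r : rel (FEx A) r = fun v => bex v (fun x => rel A (x .: r) v).
Proof.
  extensionality v. exact (f_equal (bex v)
    (functional_extensionality _ _ (rel_under A r v))).
Qed.
Lemma rel_ball i A r : rel (FBAll i A) r = fun v => ball (r i) (fun x => rel A (x .: r) v).
Proof.
  extensionality v. exact (f_equal (ball (r i))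
    (functional_extensionality _ _ (rel_under A r v))).
Qed.
Lemma rel_bex i A r : rel (FBEx i A) r = fun v => bex (r i) (fun x => rel A (x .: r) v).
Proof.
  extensionality v. exact (f_equal (bex (r i))
    (functional_extensionality _ _ (rel_under A r v))).
Qed.
Lemma rel_sall i A r : rel (FSAll i A) r = fun v => sall (r i) (fun x => rel A (x .: r) v).
Proof.
  extensionality v. exact (f_equal (sall (r i))
    (functional_extensionality _ _ (rel_under A r v))).
Qed.
Lemma rel_sex i A r : rel (FSEx i A) r = fun v => hsex mem (r i) (fun x => rel A (x .: r) v).
Proof.
  extensionality v. exact (f_equal (hsex mem (r i))
    (functional_extensionality _ _ (rel_under A r v))).
Qed.

Lemma rel_def0 A r v : def0 (rel A r v).
Proof. apply def0_ev, Delta0P_relz. Qed.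

Lemma rel_def2 A r : def2 (fun v x => rel A (x .: r) v).
Proof.
  exists (relz 0 (shift A)), r. split; [apply Delta0P_relz|reflexivity].
Qed.

Lemma hanti_hall m P : (forall x, hanti (fun v => P v x)) ->
  hanti (fun v => hall (fun x : D => himp (m x) (P v x))).
Proof.
  intros HP u v w L H x. hintro Hx. apply (HP x u v); [easy|]. exact (apply_imp (H x) Hx).
Qed.

Lemma hanti_hex m P : (forall x, hanti (fun v => P v x)) ->
  hanti (fun v => hex (fun x : D => hand (m x) (P v x))).
Proof.
  intros HP u v w L H. hdestruct H as x [Hx H]. apply hex_intro with x.
  split; [easy|]. now apply (HP x u v).
Qed.

(** The induction is simultaneous because the premise of an implication belongs to the other
    class. *)
Lemma rel_monotone :
  (forall A, SigmaP A -> forall r, hmono (rel A r)) /\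
  (forall A, PiP A -> forall r, hanti (rel A r)).
Proof.
  apply SigmaP_PiP_ind.
  - intros A HA r. rewrite (rel_Delta0 A r HA). apply const_mono.
  - intros A B _ HA _ HB r u v w L [H1 H2]. split; [eapply HA|eapply HB]; eauto.
  - intros A B _ HA _ HB r u v w L H. hcases H as K.
    + apply hor_intro1. now apply (HA r u v).
    + apply hor_intro2. now apply (HB r u v).
  - intros i A _ HA r. rewrite rel_ball. now apply (hmono_hall (fun x => mem x (r i))).
  - intros i A _ HA r. rewrite rel_bex. now apply (hmono_hex (fun x => mem x (r i))).
  - intros i A _ HA r. rewrite rel_sall. now apply (hmono_hall (fun x => hsub x (r i))).
  - intros i A _ HA r. rewrite rel_sex. now apply (hmono_hex (fun x => hsub x (r i))).
  - intros A _ HA r. rewrite rel_ex. intros u v w L H. hdestruct H as x [Hx H].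
    apply hex_intro with x. split; [exact (hsub_mem mem L Hx)|]. now apply (HA _ u v).
  - intros C _ HC r u v w L H. hintro K. apply (HC r u v) in K; [|easy].
    exact (apply_imp H K).
  - intros C A _ HC _ HA r u v w L H. hintro K. apply (HC r u v) in K; [|easy].
    apply (HA r u v); [easy|]. exact (apply_imp H K).
  - intros A HA r. rewrite (rel_Delta0 A r HA). apply const_anti.
  - intros A B _ HA _ HB r u v w L [H1 H2]. split; [eapply HA|eapply HB]; eauto.
  - intros A B _ HA _ HB r u v w L H. hcases H as K.
    + apply hor_intro1. now apply (HA r u v).
    + apply hor_intro2. now apply (HB r u v).
  - intros i A _ HA r. rewrite rel_ball. now apply (hanti_hall (fun x => mem x (r i))).
  - intros i A _ HA r. rewrite rel_bex. now apply (hanti_hex (fun x => mem x (r i))).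
  - intros i A _ HA r. rewrite rel_sall. now apply (hanti_hall (fun x => hsub x (r i))).
  - intros i A _ HA r. rewrite rel_sex. now apply (hanti_hex (fun x => hsub x (r i))).
  - intros A _ HA r. rewrite rel_all. intros u v w L H x. hintro Hx.
    apply (HA _ u v); [easy|]. exact (apply_imp (H x) (hsub_mem mem L Hx)).
  - intros C _ HC r u v w L H. hintro K. apply (HC r u v) in K; [|easy].
    exact (apply_imp H K).
  - intros C A _ HC _ HA r u v w L H. hintro K. apply (HC r u v) in K; [|easy].
    apply (HA r u v); [easy|]. exact (apply_imp H K).
Qed.

Lemma rel_sound :
  (forall A, SigmaP A -> forall r v w, rel A r v w -> eval mem A r w) /\
  (forall A, PiP A -> forall r v w, eval mem A r w -> rel A r v w).
Proof.
  apply SigmaP_PiP_ind.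
  - intros A HA r v w. now rewrite (rel_Delta0 A r HA).
  - intros A B _ HA _ HB r v w [H1 H2]. split; [eapply HA|eapply HB]; eauto.
  - intros A B _ HA _ HB r v w H. hcases H as K.
    + apply hor_intro1. now apply (HA r v).
    + apply hor_intro2. now apply (HB r v).
  - intros i A _ HA r v w. rewrite rel_ball. intros H x. hintro Hx.
    apply (HA _ v). exact (apply_imp (H x) Hx).
  - intros i A _ HA r v w. rewrite rel_bex. intros H. hdestruct H as x [Hx H].
    apply hex_intro with x. split; [easy|]. now apply (HA _ v).
  - intros i A _ HA r v w. rewrite rel_sall. intros H x. hintro Hx.
    apply (HA _ v). exact (apply_imp (H x) Hx).
  - intros i A _ HA r v w. rewrite rel_sex. intros H. hdestruct H as x [Hx H].
    apply hex_intro with x. split; [easy|]. now apply (HA _ v).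
  - intros A _ HA r v w. rewrite rel_ex. intros H. hdestruct H as x [Hx H].
    apply hex_intro with x. now apply (HA _ v).
  - intros C _ HC r v w H. hintro K. exact (apply_imp H (HC r v _ K)).
  - intros C A _ HC _ HA r v w H. hintro K. apply (HA r v).
    exact (apply_imp H (HC r v _ K)).
  - intros A HA r v w. now rewrite (rel_Delta0 A r HA).
  - intros A B _ HA _ HB r v w [H1 H2]. split; [eapply HA|eapply HB]; eauto.
  - intros A B _ HA _ HB r v w H. hcases H as K.
    + apply hor_intro1. now apply (HA r v).
    + apply hor_intro2. now apply (HB r v).
  - intros i A _ HA r v w H. rewrite rel_ball. intros x. hintro Hx.
    apply HA. exact (apply_imp (H x) Hx).
  - intros i A _ HA r v w H. rewrite rel_bex. hdestruct H as x [Hx H].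
    apply hex_intro with x. split; [easy|]. now apply HA.
  - intros i A _ HA r v w H. rewrite rel_sall. intros x. hintro Hx.
    apply HA. exact (apply_imp (H x) Hx).
  - intros i A _ HA r v w H. rewrite rel_sex. hdestruct H as x [Hx H].
    apply hex_intro with x. split; [easy|]. now apply HA.
  - intros A _ HA r v w H. rewrite rel_all. intros x. hintro Hx. apply HA, H.
  - intros C _ HC r v w H. hintro K. exact (apply_imp H (HC r v _ K)).
  - intros C A _ HC _ HA r v w H. hintro K. apply HA.
    exact (apply_imp H (HC r v _ K)).
Qed.

(** * Forcing of Sigma and Pi formulas *)

Definition covered A := forall B, In B (subformulas A) -> universal_for mem U (relz 0 (shift B)).

Lemma covered_self A r : covered A -> represented (rel A r).
Proof.
  intros H w. apply (H A). destruct A; now left.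
Qed.

Lemma covered_two A B C : incl (subformulas A ++ subformulas B) (subformulas C) ->
  covered C -> covered A /\ covered B.
Proof.
  intros I H; split; intros E HE; apply H, I, in_or_app; auto.
Qed.

Lemma covered_one A C : incl (subformulas A) (subformulas C) -> covered C -> covered A.
Proof. intros I H E HE; apply H, I, HE. Qed.

(** Simultaneous induction with one forcing clause for each formation rule. Coverage supplies a code
    wherever a goal or an added condition has to express a relativized formula. *)
Theorem forces_SigmaP_PiP :
  (forall A, SigmaP A -> covered A -> forall r, forces (fev A r) (rel A r)) /\
  (forall A, PiP A -> covered A -> forall r, forces_all (fev A r) (rel A r)).
Proof.
  destruct rel_monotone as [MS MP].
  assert (two : forall A B, let s := subformulas A ++ subformulas B in
    incl s (subformulas (FAnd A B)) /\ incl s (subformulas (FOr A B)) /\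
    incl s (subformulas (FImp A B))).
  { intros A B; simpl; repeat split; apply incl_tl, incl_refl. }
  assert (one : forall A i, let s := subformulas A in
    incl s (subformulas (FAll A)) /\ incl s (subformulas (FEx A)) /\
    incl s (subformulas (FBAll i A)) /\ incl s (subformulas (FBEx i A)) /\
    incl s (subformulas (FSAll i A)) /\ incl s (subformulas (FSEx i A))).
  { intros A i; simpl; repeat split; apply incl_tl, incl_refl. }
  assert (fixed : forall A r v, represented (fun _ => rel A r v)).
  { intros A r v. apply represented_const, rel_def0. }
  apply SigmaP_PiP_ind.
  - intros A HA _ r. rewrite (rel_Delta0 A r HA). now apply forces_Delta0.
  - intros A B SA HA SB HB H r.
    destruct (covered_two A B _ (proj1 (two A B)) H) as [KA KB].
    apply (forces_and _ _ (rel A r) (rel B r)); auto.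
  - intros A B SA HA SB HB H r.
    destruct (covered_two A B _ (proj1 (proj2 (two A B))) H) as [KA KB].
    apply (forces_or _ _ (rel A r) (rel B r)); auto.
    + exact (covered_self _ r H).
    + apply (MS (FOr A B)). now apply Sig_Or.
    + intros v; apply (rel_def0 (FOr A B)).
  - intros i A SA HA H r. assert (KA : covered A) by (revert H; apply covered_one, (one A i)).
    rewrite rel_ball.
    apply (forces_hall (fun x => mem x (r i)) (fun x => fmem x (r i))
      (fun x => fev A (x .: r)) (fun v x => rel A (x .: r) v)).
    + apply bounded_mem.
    + apply rel_def2.
    + intros; now apply MS.
    + intros; apply forces_mem.
    + intros; now apply HA.
  - intros i A SA HA H r. assert (KA : covered A) by (revert H; apply covered_one, (one A i)).
    pose proof (covered_self _ r H) as R. pose proof (rel_def0 (FBEx i A) r) as R0.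
    rewrite rel_bex in *.
    apply (forces_hex (fun x => mem x (r i)) (fun x => fmem x (r i))
      (fun x => fev A (x .: r)) (fun v x => rel A (x .: r) v)); [easy|easy| | |].
    + intros; now apply MS.
    + intros; apply forces_mem.
    + intros; now apply HA.
  - intros i A SA HA H r. assert (KA : covered A) by (revert H; apply covered_one, (one A i)).
    rewrite rel_sall.
    apply (forces_hall (fun x => hsub x (r i)) (fun x => hincl fmem x (r i))
      (fun x => fev A (x .: r)) (fun v x => rel A (x .: r) v)).
    + apply bounded_sub.
    + apply rel_def2.
    + intros; now apply MS.
    + intros; apply forces_sub.
    + intros; now apply HA.
  - intros i A SA HA H r. assert (KA : covered A) by (revert H; apply covered_one, (one A i)).
    pose proof (covered_self _ r H) as R. pose proof (rel_def0 (FSEx i A) r) as R0.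
    rewrite rel_sex in *.
    apply (forces_hex (fun x => hsub x (r i)) (fun x => hincl fmem x (r i))
      (fun x => fev A (x .: r)) (fun v x => rel A (x .: r) v)); [easy|easy| | |].
    + intros; now apply MS.
    + intros; apply forces_sub.
    + intros; now apply HA.
  - intros A SA HA H r. assert (KA : covered A) by (revert H; apply covered_one, (one A 0)).
    pose proof (covered_self _ r H) as R. pose proof (rel_def0 (FEx A) r) as R0.
    rewrite rel_ex in *.
    apply (forces_unbounded_hex (fun x => fev A (x .: r)) (fun v x => rel A (x .: r) v));
      [easy|easy| |].
    + intros; now apply MS.
    + intros; now apply HA.
  - intros C SC HC H r.
    destruct (covered_two C FBot _ (proj2 (proj2 (two C FBot))) H) as [KC _].
    apply (forces_imp _ _ (rel C r) (rel FBot r)).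
    + now apply covered_self.
    + now apply MP.
    + apply (MS FBot). now apply Sig_D0.
    + now apply HC.
    + exact (forces_Delta0 FBot I r).
  - intros C A SC HC SA HA H r.
    destruct (covered_two C A _ (proj2 (proj2 (two C A))) H) as [KC KA].
    apply (forces_imp _ _ (rel C r) (rel A r)); auto. now apply covered_self.
  - intros A HA _ r. rewrite (rel_Delta0 A r HA). now apply forces_all_const, forces_Delta0.
  - intros A B SA HA SB HB H r.
    destruct (covered_two A B _ (proj1 (two A B)) H) as [KA KB].
    apply (forces_all_and _ _ (rel A r) (rel B r)); auto.
  - intros A B SA HA SB HB H r.
    destruct (covered_two A B _ (proj1 (proj2 (two A B))) H) as [KA KB].
    apply (forces_all_or _ _ (rel A r) (rel B r)); auto using covered_self.
    + intros v; exact (fixed (FOr A B) r v).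
    + intros v; apply (rel_def0 (FOr A B)).
  - intros i A SA HA H r. assert (KA : covered A) by (revert H; apply covered_one, (one A i)).
    rewrite rel_ball.
    apply (forces_all_hall (fun x => mem x (r i)) (fun x => fmem x (r i))
      (fun x => fev A (x .: r)) (fun v x => rel A (x .: r) v)).
    + apply bounded_mem.
    + apply rel_def2.
    + intros; apply forces_mem.
    + intros; now apply HA.
  - intros i A SA HA H r. assert (KA : covered A) by (revert H; apply covered_one, (one A i)).
    pose proof (fixed (FBEx i A) r) as R. pose proof (rel_def0 (FBEx i A) r) as R0.
    rewrite rel_bex in *.
    apply (forces_all_hex (fun x => mem x (r i)) (fun x => fmem x (r i))
      (fun x => fev A (x .: r)) (fun v x => rel A (x .: r) v));
      [apply bounded_mem|apply rel_def2|easy|easy| | | |].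
    + intros; now apply (covered_self A).
    + intros; now apply MP.
    + intros; apply forces_mem.
    + intros; now apply HA.
  - intros i A SA HA H r. assert (KA : covered A) by (revert H; apply covered_one, (one A i)).
    rewrite rel_sall.
    apply (forces_all_hall (fun x => hsub x (r i)) (fun x => hincl fmem x (r i))
      (fun x => fev A (x .: r)) (fun v x => rel A (x .: r) v)).
    + apply bounded_sub.
    + apply rel_def2.
    + intros; apply forces_sub.
    + intros; now apply HA.
  - intros i A SA HA H r. assert (KA : covered A) by (revert H; apply covered_one, (one A i)).
    pose proof (fixed (FSEx i A) r) as R. pose proof (rel_def0 (FSEx i A) r) as R0.
    rewrite rel_sex in *.
    apply (forces_all_hex (fun x => hsub x (r i)) (fun x => hincl fmem x (r i))
      (fun x => fev A (x .: r)) (fun v x => rel A (x .: r) v));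
      [apply bounded_sub|apply rel_def2|easy|easy| | | |].
    + intros; now apply (covered_self A).
    + intros; now apply MP.
    + intros; apply forces_sub.
    + intros; now apply HA.
  - intros A SA HA H r. assert (KA : covered A) by (revert H; apply covered_one, (one A 0)).
    rewrite rel_all.
    apply (forces_all_unbounded_hall (fun x => fev A (x .: r)) (fun v x => rel A (x .: r) v)).
    + apply rel_def2.
    + intros; now apply MP.
    + intros; now apply HA.
  - intros C SC HC H r.
    destruct (covered_two C FBot _ (proj2 (proj2 (two C FBot))) H) as [KC _].
    apply (forces_all_imp _ _ (rel C r) (rel FBot r)).
    + apply rel_def0.
    + apply rel_def0.
    + now apply MS.
    + apply (MP FBot). now apply Pi_D0.
    + now apply HC.
    + exact (forces_all_const _ _ (forces_Delta0 FBot I r)).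
  - intros C A SC HC SA HA H r.
    destruct (covered_two C A _ (proj2 (proj2 (two C A))) H) as [KC KA].
    apply (forces_all_imp _ _ (rel C r) (rel A r)); auto; intros; apply rel_def0.
Qed.

(** * Definability of forcing and set induction *)

Definition definable (X : (nat -> D) -> ftv) :=
  exists F, forall r p w, slice (X r) p w <-> eval mem F (p .: r) w.

(** Its quantifier over stages is unbounded, so forcing is not bounded-definable; set induction,
    being available for all formulas, tolerates this. *)
Definition EventualTarget k q := FEx (FImp (Approx (S q) 0) (Target (S k) 0)).

Lemma ev_EventualTarget k q r : eval mem (EventualTarget k q) r = eventually (r q) (target (r k)).
Proof.
  unfold EventualTarget, eventually; cbn [eval]. f_equal; extensionality v.
  now rewrite ev_Approx, ev_Target.
Qed.

(* The variables of the quantifier prefix are p' q k p, in this order. *)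
Lemma definable_jcl (X : (nat -> D) -> world forcing_beth -> Prop) F :
  (forall r w p, X r (w, p) -> eval mem F (p .: r) w) ->
  (forall r w p, eval mem F (p .: r) w -> jcl (fun v => X r (v, p)) w) ->
  definable (fun r => hjcl (X r)).
Proof.
  intros H1 H2.
  (* Goals and conditions in the definition of the nucleus become quantifiers over sets, while the
     ground worlds are absorbed by the implications. *)
  exists (FAll (FAll (FImp (FSub 2 0) (FImp (FAll (FImp (FSub 1 0) (FImp
    (rename (fun n => match n with 0 => 0 | S n => 4 + n end) F) (EventualTarget 2 0))))
    (EventualTarget 1 0))))).
  intros r p w.
  assert (EF : forall p' q k, eval mem (rename (fun n => match n with 0 => 0 | S n => 4 + n end) F)
    (p' .: q .: k .: p .: r) = eval mem F (p' .: r)).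
  { intros; rewrite eval_rename; f_equal; extensionality n; now destruct n. }
  split.
  - intros H k q v L Hpq v' L' Hh. rewrite ev_EventualTarget. cbn [scons]. up_along L'.
    apply (H k (v', q)); [split; [eapply le_trans; eauto|exact Hpq]|].
    intros [u p'] [Lu Hp'] HX; cbn in *.
    assert (Q : eval mem (EventualTarget 2 0) (p' .: q .: k .: p .: r) u).
    { apply (Hh p' u Lu Hp' u (le_refl u)). rewrite EF. now apply H1. }
    rewrite ev_EventualTarget in Q. exact Q.
  - intros H k [v q] [L Hp] Hk; cbn in *. 
    pose proof (ev_EventualTarget 1 0 (q .: k .: p .: r)) as EG. cbn [scons] in EG.
    rewrite <- EG. apply (H k q v L Hp v (le_refl v)).
    intros p' u Lu Hp' u' Lu' HF. rewrite EF in HF.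
    change (eval mem (EventualTarget 2 0) (p' .: q .: k .: p .: r) u').
    rewrite ev_EventualTarget. cbn [scons].
    apply H2 in HF. apply (jcl_elim _ _ _ HF). intros t Lt HX. apply (Hk (t, p')); [|easy].
    split; cbn; [repeat (eapply le_trans; [eassumption|]); apply le_refl|].
    eapply holds_mono; [|exact Hp']. eapply le_trans; eauto.
Qed.

Lemma definable_fmem i j : definable (fun r => fmem (r i) (r j)).
Proof.
  apply definable_jcl with (F := FEx (FImp (Approx 1 0) (FIn (S (S i)) (S (S j))))).
  - intros r w p H. cbn [eval]. refine (eq_ind _ (fun f => hex f w) H _ _).
    extensionality v. now rewrite ev_Approx.
  - intros r w p H. cbn [eval] in H. apply jcl_intro. intros v L. up_along L.
    refine (eq_ind _ (fun f => hex f v) H _ _).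
    extensionality u. now rewrite ev_Approx.
Qed.

Lemma definable_hbot : definable (fun _ => hbot).
Proof.
  apply definable_jcl with (F := FBot); [easy|]. intros r w p H. exact H.
Qed.

Lemma definable_hand X Y : definable X -> definable Y -> definable (fun r => hand (X r) (Y r)).
Proof.
  intros [F HF] [G HG]. exists (FAnd F G). intros r p w. split; intros [H1 H2].
  - split; [now apply HF|now apply HG].
  - split; [now apply HF in H1|now apply HG in H2].
Qed.

Lemma definable_hor X Y : definable X -> definable Y -> definable (fun r => hor (X r) (Y r)).
Proof.
  intros [F HF] [G HG]. apply definable_jcl with (F := FOr F G).
  - intros r w p [H|H]; [apply hor_intro1|apply hor_intro2]; [now apply HF|now apply HG].
  - intros r w p H. apply (hor_elim _ _ _ H (hjcl (fun v => X r (v, p) \/ Y r (v, p))));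
      intros v _ K; apply jcl_intro; intros u L; up_along L; [left|right];
      [now apply HF in K|now apply HG in K].
Qed.

Lemma definable_himp X Y : definable X -> definable Y -> definable (fun r => himp (X r) (Y r)).
Proof.
  intros [F HF] [G HG].
  set (f := fun n => match n with 0 => 0 | S n => 2 + n end).
  exists (FAll (FImp (FSub 1 0) (FImp (rename f F) (rename f G)))). intros r p w.
  assert (E : forall A q, eval mem (rename f A) (q .: p .: r) = eval mem A (q .: r)).
  { intros A q. rewrite eval_rename. f_equal. extensionality n; now destruct n. }
  rewrite slice_imp. split.
  - intros H q v L Hq v' L' Hx. rewrite E in *. apply HG. apply HF in Hx.
    apply H; [eapply le_trans; eauto| |easy]. eapply holds_mono; eauto.
  - intros H q v L Hq Hx. apply HG. apply HF in Hx.
    rewrite <- E with (q := q). apply (H q v L Hq v (le_refl v)). now rewrite E.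
Qed.

Lemma ev_swap F x p r : eval mem (rename (fun n => match n with 0 => 1 | 1 => 0 | S n => S n end) F)
  (x .: p .: r) = eval mem F (p .: x .: r).
Proof.
  rewrite eval_rename. f_equal. extensionality n; destruct n as [|[|n]]; reflexivity.
Qed.

Lemma definable_hall X : definable X -> definable (fun r => hall (fun x => X (x .: r))).
Proof.
  intros [F HF].
  exists (FAll (rename (fun n => match n with 0 => 1 | 1 => 0 | S n => S n end) F)).
  intros r p w. split; intros H x.
  - rewrite ev_swap. apply HF, H.
  - specialize (H x). cbn beta in H. rewrite ev_swap in H. now apply HF in H.
Qed.

Lemma definable_hex X : definable X -> definable (fun r => hex (fun x => X (x .: r))).
Proof.
  intros [F HF]. apply definable_jcl with
    (F := FEx (rename (fun n => match n with 0 => 1 | 1 => 0 | S n => S n end) F)).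
  - intros r w p [x H]. apply hex_intro with x. rewrite ev_swap. now apply HF.
  - intros r w p H.
    apply (hex_elim _ _ H (hjcl (fun v => exists x, X (x .: r) (v, p)))).
    intros x v _ K. rewrite ev_swap in K. apply jcl_intro; intros u L; up_along L.
    exists x. now apply HF in K.
Qed.

Lemma definable_hsub i : definable (fun r => hincl fmem (r 0) (r (S i))).
Proof.
  apply (definable_hall (fun r => himp (fmem (r 0) (r 1)) (fmem (r 0) (r (S (S i)))))).
  apply definable_himp; apply definable_fmem.
Qed.

Lemma definable_ev A : definable (fev A).
Proof.
  induction A; cbn [eval].
  - apply definable_fmem.
  - apply definable_hbot.
  - now apply definable_hand.
  - now apply definable_hor.
  - now apply definable_himp.
  - now apply definable_hall.
  - now apply definable_hex.
  - apply (definable_hall (fun r => himp (fmem (r 0) (r (S n))) (fev A r))).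
    apply definable_himp; [apply definable_fmem|easy].
  - apply (definable_hex (fun r => hand (fmem (r 0) (r (S n))) (fev A r))).
    apply definable_hand; [apply definable_fmem|easy].
  - apply (definable_hall (fun r => himp (hincl fmem (r 0) (r (S n))) (fev A r))).
    apply definable_himp; [apply definable_hsub|easy].
  - apply (definable_hex (fun r => hand (hincl fmem (r 0) (r (S n))) (fev A r))).
    apply definable_hand; [apply definable_hsub|easy].
Qed.

(** Ground set induction is applied to the formula saying that the fixed condition [q] forces [C]. A
    forced membership of [y] in [x] holds only eventually; [cover] reduces it to an actual one. *)
Lemma forcing_induction C r p w :
  slice (fev (FImp (FAll (FImp (FBAll 0 (rename (up S) C)) C)) (FAll C)) r) p w.
Proof.
  destruct (definable_ev C) as [F HF]. apply slice_imp. intros q v L Hq H.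
  set (C' := rename (fun n => match n with 0 => 1 | 1 => 0 | S n => S n end) F).
  assert (K : hall (fun x => eval mem C' (x .: q .: r)) v).
  { apply (set_induction mem valid). intros x u Lu Hx. unfold C'. rewrite ev_swap.
    apply HF. apply (H x (u, q)); [split; [exact Lu|apply hsub_refl]|].
    intros y [t q'] [Lt Hq'] Hy; cbn in *.
    pose proof (proj1 (forces_mem y x q' t) Hy) as Hy'.
    assert (E : fev (rename (up S) C) (y .: x .: r) = fev C (y .: r)).
    { rewrite eval_rename. f_equal. extensionality n; now destruct n. }
    change (fev (rename (up S) C) (y .: x .: r) (t, q')). rewrite E.
    change (slice (fev C (y .: r)) q' t).
    apply (cover (mem y x)); [now exists (FIn 0 1), (y .: fun _ => x)|easy|].
    intros t' Lt' Hyx. up_along Lt'.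
    apply (slice_cond _ q); [easy|]. apply HF.
    rewrite <- ev_swap. exact (Hx y t' (le_trans _ _ _ Lt Lt') Hyx). }
  intros x. apply HF. specialize (K x). unfold C' in K. cbn beta in K.
  now rewrite ev_swap in K.
Qed.

(** * Reflection and the other axioms in the forcing model *)

Lemma forcing_reflection A r p w : SigmaP A -> covered A ->
  slice (fev (FImp A (FEx (relz 0 (shift A)))) r) p w.
Proof.
  intros SA CA. apply slice_imp. intros q v _ _ H.
  apply (proj1 forces_SigmaP_PiP A SA CA r) in H. hdestruct H as u Hu.
  (* The stage [u] serves twice: as the reflecting set, and as the stage at which the resulting
     bounded formula holds eventually. *)
  apply (hex_intro (fun x => fev (relz 0 (shift A)) (x .: r)) u).
  apply (forces_Delta0 _ (Delta0P_relz _ _)). apply hex_intro with u. exact Hu.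
Qed.

(** Extensionality, Pair, Union, Infinity, Separation and Power Set are built from bounded formulas
    by conjunction and unbounded quantifiers, along which truth passes to forcing. *)
Definition lifts A := forall r p w, eval mem A r w -> slice (fev A r) p w.

Lemma lifts_Delta0 A : Delta0P A -> lifts A.
Proof. intros HA r p w H. apply (forces_Delta0 A HA r). now apply eventually_const. Qed.

Lemma lifts_and A B : lifts A -> lifts B -> lifts (FAnd A B).
Proof. intros HA HB r p w [H1 H2]. split; [now apply HA|now apply HB]. Qed.

Lemma lifts_all A : lifts A -> lifts (FAll A).
Proof. intros HA r p w H x. apply HA, H. Qed.

Lemma lifts_ex A : lifts A -> lifts (FEx A).
Proof.
  intros HA r p w H. hdestruct H as x Hx.
  apply (hex_intro (fun x => fev A (x .: r)) x). now apply HA.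
Qed.

Theorem forcing_valid A : IKPP_Refl A ->
  (forall C, A = FImp C (FEx (relz 0 (shift C))) -> covered C) ->
  forall r wp, fev A r wp.
Proof.
  intros HA HC r [w p]. change (slice (fev A r) p w).
  assert (L : forall B, IKPP B -> lifts B -> slice (fev B r) p w)
    by (intros B HI HL; now apply HL, valid).
  revert HC.
  destruct HA as [HA|[C SC]]; [|intros HC; apply forcing_reflection; [easy|exact (HC C eq_refl)]].
  destruct HA; intros HC.
  - apply L; [now constructor|]. apply lifts_Delta0. simpl. unfold subst0.
    repeat split; now apply Delta0P_rename.
  - apply L; [now constructor|]. apply lifts_ex, lifts_Delta0; simpl; auto.
  - apply L; [now constructor|]. apply lifts_ex, lifts_Delta0; simpl; auto.
  - apply L; [now constructor|]. apply lifts_ex, lifts_and; [apply lifts_ex|];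
      apply lifts_Delta0; simpl; auto.
  - apply L; [now constructor|]. apply lifts_ex, lifts_all, lifts_Delta0; simpl.
    assert (Delta0P (rename (up S) B)) by now apply Delta0P_rename. tauto.
  (* Collection is literally the reflection of its own premise, because relativization leaves the
     bounded [B] unchanged. *)
  - pose (C := FBAll a (FEx B)).
    assert (E : FImp (FBAll a (FEx B))
       (FEx (FBAll (S a) (FBEx 1 (rename (up (up S)) B)))) = FImp C (FEx (relz 0 (shift C)))).
    { unfold C, shift. cbn. rewrite relz_Delta0; [reflexivity|now apply Delta0P_rename]. }
    rewrite E. apply forcing_reflection; [|exact (HC C E)].
    now apply Sig_BAll, Sig_Ex, Sig_D0.
  - apply forcing_induction.
  - apply L; [now constructor|]. apply lifts_ex, lifts_Delta0; simpl; auto.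
Qed.

End Forcing.

(** * From derivations with reflection to conservativity *)

Lemma prv_mono T T' G A : (forall B, T B -> T' B) -> prv T G A -> prv T' G A.
Proof.
  intros H; induction 1; eauto using P_Ctx, P_Ax, P_Bq, P_BotE, P_ImpI, P_ImpE, P_AndI,
    P_AndE1, P_AndE2, P_OrI1, P_OrI2, P_OrE, P_AllI, P_AllE, P_ExI, P_ExE.
Qed.

(** The restriction concerns the shape of [A] and not the schema it comes from, so [L] also lists
    the premises of collection instances, which are forced as reflections. *)
Definition reflects (L : list form) (A : form) :=
  IKPP_Refl A /\ forall C, A = FImp C (FEx (relz 0 (shift C))) -> In C L.

Lemma prv_finitely_many_reflections G A : prv IKPP_Refl G A -> exists L, prv (reflects L) G A.
Proof.
  assert (mono : forall L L' G A, incl L L' -> prv (reflects L) G A -> prv (reflects L') G A).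
  { intros L L' G' A' I. apply prv_mono. intros B [H1 H2]; split; auto. }
  assert (left : forall L L' G A, prv (reflects L) G A -> prv (reflects (L ++ L')) G A).
  { intros L L' G' A'. apply mono. now apply incl_appl, incl_refl. }
  assert (right : forall L L' G A, prv (reflects L') G A -> prv (reflects (L ++ L')) G A).
  { intros L L' G' A'. apply mono. now apply incl_appr, incl_refl. }
  induction 1;
    repeat match goal with H : exists L, _ |- _ => destruct H as [? H] end.
  (* The antecedent of every implication used as an axiom is recorded, whichever schema it belongs
     to. *)
  2:{ exists (match A with FImp C _ => [C] | _ => [] end). apply P_Ax. split; [easy|].
      intros C ->. now left. }
  all: try (exists []; solve [now apply P_Ctx|now apply P_Bq]).
  - exists x. now apply P_BotE.
  - exists x. now apply P_ImpI.
  - exists (x ++ x0). eapply P_ImpE; eauto.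
  - exists (x ++ x0). apply P_AndI; eauto.
  - exists x. eapply P_AndE1; eauto.
  - exists x. eapply P_AndE2; eauto.
  - exists x. now apply P_OrI1.
  - exists x. now apply P_OrI2.
  - exists (x ++ (x0 ++ x1)). eapply P_OrE; eauto.
  - exists x. now apply P_AllI.
  - exists x. now apply P_AllE.
  - exists x. now apply P_ExI with t.
  - exists (x ++ x0). eapply P_ExE; eauto.
Qed.

Theorem theorem3p29 : forall A : form,
  sentence A -> SigmaP A -> Provable IKPP_Refl A -> Provable IKPP A.
Proof.
  intros A _ SA HA. destruct (prv_finitely_many_reflections _ _ HA) as [L HL].
  pose (mem := term_mem IKPP).
  pose proof (fun A H r w => term_model_valid IKPP IKPP_rename A r w H) as valid.
  fold mem in valid.
  pose (truth := FBEx 1 (FImp FBot FBot)).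
  (* [U] has to code the relativized subformulas of [A] and of the finitely many formulas in [L],
     and also inhabitedness, through which bounded truth values are coded. *)
  destruct (exists_universal mem valid
    (truth :: flat_map (fun C => map (fun B => relz 0 (shift B)) (subformulas C)) (A :: L)))
    as (U & HU & HUL).
  { intros B [<-|HB]; [simpl; tauto|]. apply in_flat_map in HB as (C & _ & HB).
    apply in_map_iff in HB as (E & <- & _). apply Delta0P_relz. }
  assert (HT : universal_for mem U truth) by (apply HUL; now left).
  assert (HC : forall C, In C (A :: L) -> covered mem U C).
  { intros C HC B HB. apply HUL. right. apply in_flat_map. exists C.
    split; [easy|]. apply in_map_iff. now exists B. }
  assert (S : forall p w, slice mem U (eval (fmem mem U) A (fun n => n)) p w).
  { intros p w. apply (soundness (fmem mem U) (reflects L) [] A); [|exact HL|easy].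
    intros B [HB HBL]. apply forcing_valid; try assumption.
    intros C E. apply HC. right. now apply HBL. }
  (* Truth at the empty context of the term model is derivability without assumptions. *)
  cut (eval mem A (fun n => n) []).
  { intros H. apply (eval_iff_prv IKPP IKPP_rename) in H. now rewrite rename_id in H. }
  (* All approximations of an empty condition hold vacuously, so forcing by it makes some
     relativization of [A] true, and [rel_sound] passes from there to [A]. *)
  hdestruct (empty_set mem valid (fun n => n) []) as p Hp.
  pose proof (proj1 (proj1 (forces_SigmaP_PiP mem valid U HU HT) A SA
    (HC A (or_introl eq_refl)) (fun n => n) p w) (S p w)) as H.
  hdestruct H as v Hv.
  apply (proj1 (rel_sound mem) A SA (fun n => n) v). apply (apply_imp Hv).
  intros s. hintro Hs. apply hbot_elim. exact (apply_imp (Hp s) Hs).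
Qed.
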